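(* Let $k\in\mathbb{N}$ and let $f_1(x),\dots,f_k(x)\in\mathbb{R}[x]$ be polynomials such that $\deg f_1=1$ and such that, for every non-zero $\mathbf{h}=(h_1,\dots,h_k)\in\mathbb{Z}^k$, the polynomial $$F_{\mathbf{h}}(x):=h_1f_1(x)+\cdots+h_kf_k(x)$$ has an irrational coefficient other than its constant term. Then the density below exists and $$\mathrm{dens}\big(\{n\in\mathbb{N}:\gcd(n,\lfloor f_1(n)\rfloor,\dots,\lfloor f_k(n)\rfloor)=1\}\big)=\frac{1}{\zeta(k+1)}.$$
   Context: $\mathbb{N}=\{1,2,3,\dots\}$; $\lfloor x\rfloor$ is the integer part of $x\in\mathbb{R}$; $\zeta$ is the Riemann zeta function. The density of $\mathcal{A}\subseteq\mathbb{N}$ is $\mathrm{dens}\,\mathcal{A}:=\lim_{N\to\infty}|\mathcal{A}\cap\{1,\dots,N\}|/N$, when this limit exists. *)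

(* Defs.v *)
From HB Require Import structures.
From mathcomp Require Import all_boot all_order all_algebra.
From mathcomp Require Import all_classical all_reals all_analysis.

Set Implicit Arguments.
Unset Strict Implicit.
Unset Printing Implicit Defensive.
Import Order.TTheory GRing.Theory Num.Theory.
Import numFieldNormedType.Exports.
Local Open Scope classical_set_scope.
Local Open Scope ring_scope.

(* The term of index N = 0 is 0 / 0 = 0; it does not affect the limit. *)
Definition density_ratio (R : realType) (A : set nat) (N : nat) : R :=
  (count (mem A) (iota 1 N))%:R / N%:R.

(* Meaningful only when [density_ratio R A] converges. *)
Definition dens (R : realType) (A : set nat) : R :=
  limn (density_ratio R A).

(* The Riemann zeta function on the half-line s > 1, where it is given by its
   Dirichlet series; for s <= 1 the value is meaningless. *)
Definition zeta (R : realType) (s : R) : R :=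
  limn (fun N : nat => \sum_(1 <= n < N.+1) (n%:R `^ s)^-1).

Definition lincomb (R : realType) (k : nat) (h : 'I_k -> int)
    (f : 'I_k -> {poly R}) : {poly R} :=
  \sum_(i < k) (h i)%:~R *: f i.

(* gcd(n, |_f_1(n)_|, ..., |_f_k(n)_|); the gcd of integers is that of their
   absolute values, and 0 is neutral for gcdn. *)
Definition gcd_floors (R : realType) (k : nat) (f : 'I_k -> {poly R})
    (n : nat) : nat :=
  gcdn n (\big[gcdn/0%N]_(i < k) absz (Num.floor (f i).[n%:R])).

(* Main.v *)
(** By Weyl's theorem the vectors (f_1(d m) / d, ..., f_k(d m) / d) are
    equidistributed modulo 1, so the set of n for which d divides n and every
    floor (f_i n) has density d^-(k+1).  Removing one prime at a time, the n for
    which no prime p <= y divides the gcd have density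
    prod_(p <= y) (1 - p^-(k+1)), which tends to 1 / zeta(k+1) by Euler's product.

    The remaining n have a common divisor d > y of n and floor (f_1 n).  With
    f_1(x) = a x + b and n = d m, the number m a is within (1 + |b|) / d of an
    integer.  Let q <= sqrt N < p be the denominators of consecutive convergents
    of a.  For d = O(q), resp. d = O(N / p), the spacing of the multiples of a over
    blocks of length q, resp. p, leaves O(N / d^2) such m <= N / d; for every other
    d, m is a multiple of q.  So at most O(N / y) + N / q integers n <= N are
    affected, and q tends to infinity with N since a is irrational.

    Exponential sums are handled through their real parts: cosp and sinp are
    cos (2 pi x) and sin (2 pi x), and constant terms absorb the phases. *)
Require Import Defs.
From mathcomp Require Import all_boot all_order all_algebra.
From mathcomp Require Import all_classical all_reals all_analysis.
From mathcomp Require Import ring lra zify.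
Set Implicit Arguments.
Unset Strict Implicit.
Unset Printing Implicit Defensive.
Import Order.TTheory GRing.Theory Num.Theory.
Import numFieldNormedType.Exports.
Local Open Scope classical_set_scope.
Local Open Scope ring_scope.

(** * Cesàro averages and van der Corput's inequality *)

Section Averages.
Context {R : realType}.
Implicit Types (u v : nat -> R) (l : R).

(** Density is not countably additive, so the densities for finite sets of primes give the answer
    only together with a bound on large common divisors that is uniform in N; equidistribution for a
    fixed d says nothing once d grows with N. The polynomial of degree one supplies this bound,
    because divisibility of its floor by d puts a Diophantine constraint on m a alone. No
    Diophantine condition is imposed on a, so q and p may both be far from sqrt N. The two block
    lengths together reach d of order max(q, N / p), and this is exactly the range beyond which
    closeness of m a to an integer forces q to divide m. *)

Definition avg u (N : nat) : R := (\sum_(n < N) u n) / N%:R.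

Lemma cvg_sumr (I : Type) (r : seq I) (P : pred I) (u : I -> nat -> R) (l : I -> R) :
  (forall i, P i -> u i @ \oo --> l i) ->
  (fun N => \sum_(i <- r | P i) u i N) @ \oo --> \sum_(i <- r | P i) l i.
Proof.
move=> ul; elim: r => [|i r IHr].
  by under eq_fun do rewrite big_nil; rewrite big_nil; exact: cvg_cst.
under eq_fun do rewrite big_cons.
rewrite big_cons; case: ifPn => // Pi.
by apply: cvgD => //; exact: ul.
Qed.

Lemma cvg_invn (c : R) : (fun N : nat => c / N%:R) @ \oo --> (0 : R).
Proof.
apply/cvgrPdist_le => e e0.
near=> N.
have N0 : 0 < N%:R :> R by rewrite ltr0n; near: N; exact: nbhs_infty_gt.
rewrite sub0r normrN normrM normfV (ger0_norm (ltW N0)) ler_pdivrMr //.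
rewrite mulrC -ler_pdivrMr //; near: N; exact: nbhs_infty_ger.
Unshelve. all: by end_near. Qed.

Lemma avgN u N : avg (fun n => - u n) N = - avg u N.
Proof. by rewrite /avg sumrN mulNr. Qed.

Lemma avgD u v N : avg (fun n => u n + v n) N = avg u N + avg v N.
Proof. by rewrite /avg big_split mulrDl. Qed.

Lemma avgZ (a : R) u N : avg (fun n => a * u n) N = a * avg u N.
Proof. by rewrite /avg -mulr_sumr mulrA. Qed.

Lemma avg_sum (I : Type) (r : seq I) (P : pred I) (u : I -> nat -> R) N :
  avg (fun n => \sum_(i <- r | P i) u i n) N = \sum_(i <- r | P i) avg (u i) N.
Proof. by rewrite /avg exchange_big mulr_suml. Qed.

Lemma avg_cst (c : R) N : (0 < N)%N -> avg (fun=> c) N = c.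
Proof.
move=> N0; rewrite /avg sumr_const card_ord -[c *+ N]mulr_natr mulfK //.
by rewrite pnatr_eq0 -lt0n.
Qed.

Lemma cvg_avg_cst (c : R) : avg (fun=> c) @ \oo --> c.
Proof.
by apply: cvg_near_cst; exists 1%N => // N /= N0; rewrite avg_cst.
Qed.

Lemma le_avg u v N : (forall n, u n <= v n) -> avg u N <= avg v N.
Proof. by move=> uv; rewrite ler_wpM2r ?invr_ge0 ?ler0n // ler_sum. Qed.

Lemma eq_avg u v N : u =1 v -> avg u N = avg v N.
Proof. by move=> uv; congr (_ / _); apply: eq_bigr => n _. Qed.

(** Only the window of length q past N and the one at the origin survive, so for bounded F the
    effect of a shift does not grow with N. *)
Lemma sum_shift_sub (F : nat -> R) (q N : nat) :
  \sum_(n < N) (F (n + q)%N - F n) = \sum_(j < q) (F (N + j)%N - F j).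
Proof.
rewrite !sumrB -!(big_mkord xpredT F) -!(big_mkord xpredT (fun n => F (n + q)%N)).
rewrite -(big_mkord xpredT (fun n => F (N + n)%N)).
have -> : \sum_(0 <= n < N) F (n + q)%N = \sum_(q <= n < N + q) F n.
  by rewrite -[q in RHS]add0n big_addn add0n addnK.
have -> : \sum_(0 <= n < q) F (N + n)%N = \sum_(N <= n < N + q) F n.
  rewrite addnC -[N in RHS]add0n big_addn add0n addnK.
  by apply: eq_bigr => i _; rewrite addnC.
have := @big_cat_nat R 0 +%R q 0 (N + q) xpredT F (leq0n _) (leq_addl _ _).
have := @big_cat_nat R 0 +%R N 0 (N + q) xpredT F (leq0n _) (leq_addr _ _).
move=> /= -> /(canRL (addKr _)) ->; ring.
Qed.

Lemma sum_shift_bound (F : nat -> R) (B : R) (q N : nat) :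
  (forall n, `|F n| <= B) ->
  `|\sum_(n < N) (F (n + q)%N - F n)| <= q%:R * (2 * B).
Proof.
move=> FB; rewrite sum_shift_sub (le_trans (ler_norm_sum _ _ _)) //.
rewrite -[X in _ <= X%:R * _](card_ord q) mulr_natl -sumr_const.
apply: ler_sum => j _.
by rewrite (le_trans (ler_normB _ _)) // mulr2n mulrDl mul1r lerD.
Qed.

(* Averaging over H = K^2 shifts leaves the mean unchanged up to O(1/N); the
   square of the shifted sum is controlled by the correlations, whose diagonal
   contributes H. The bound |x| <= (x^2 / K + K) / 2 replaces Cauchy-Schwarz. *)
Lemma van_der_corput (c s : nat -> R) :
  (forall n, `|c n| <= 1) -> (forall n, `|s n| <= 1) ->
  (forall h h', h != h' ->
    avg (fun n => c (n + h)%N * c (n + h')%N + s (n + h)%N * s (n + h')%N)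
      @ \oo --> (0 : R)) ->
  avg c @ \oo --> (0 : R).
Proof.
move=> c1 s1 cor; apply/cvgrPdist_le => e e0.
(* Diagonal and off-diagonal correlations total at most 3 H, which bounds the mean of [C] by 2 K.
   Dividing by H = K^2 leaves 2 / K <= e / 2; the other e / 2 pays for the shift error 2 H / N. *)
have [K K0 Ke] : exists2 K : nat, (0 < K)%N & 4 / e <= K%:R.
  exists (Num.truncn (4 / e)).+1 => //.
  by rewrite ltW // truncnS_gt.
have K0r : 0 < K%:R :> R by rewrite ltr0n.
pose H := (K ^ 2)%N.
have Hr : H%:R = K%:R ^+ 2 :> R by rewrite natrX.
pose X (i : 'I_H * 'I_H) n :=
  c (n + i.1)%N * c (n + i.2)%N + s (n + i.1)%N * s (n + i.2)%N.
pose C n := \sum_(h < H) c (n + h)%N.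
pose S n := \sum_(h < H) s (n + h)%N.
have CS n : C n ^+ 2 + S n ^+ 2 = \sum_i X i n.
  rewrite -(pair_bigA _ (fun i j => X (i, j) n)) /= /X /= !expr2 /C /S.
  rewrite !mulr_suml -big_split; apply: eq_bigr => i _.
  by rewrite !mulr_sumr -big_split.
have off : (fun N => \sum_(i | i.1 != i.2) avg (X i) N) @ \oo --> (0 : R).
  rewrite [X in _ --> X](_ : 0 = \sum_(i : 'I_H * 'I_H | i.1 != i.2) 0); last first.
    by rewrite big1.
  by apply: cvg_sumr => i ii; exact: cor.
have Hgt0 : 0 < H%:R :> R by rewrite Hr exprn_gt0.
have diag N : \sum_(i | ~~ (i.1 != i.2)) avg (X i) N <= 2 * H%:R.
  have -> : 2 * H%:R = \sum_(i : 'I_H) 2 :> R.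
    by rewrite sumr_const card_ord mulr_natr.
  rewrite (eq_bigl (fun i : 'I_H * 'I_H => (xpredT i.1) && (i.2 == i.1))); last first.
    by move=> i; rewrite negbK eq_sym.
  rewrite (eq_bigr (fun p : 'I_H * 'I_H => (fun i j => avg (X (i, j)) N) p.1 p.2)); last by case.
  rewrite -(pair_big_dep xpredT (fun i j => j == i) (fun i j => avg (X (i, j)) N)) /=.
  apply: ler_sum => i _; rewrite big_pred1_eq.
  case: (posnP N) => [->|N0]; first by rewrite /avg big_ord0 mul0r.
  rewrite -[leRHS](avg_cst 2 N0); apply: le_avg => n; rewrite /X /=.
  have := c1 (n + i)%N; have := s1 (n + i)%N.
  rewrite -!expr2 -(real_normK (num_real (c _))) -(real_normK (num_real (s _))).
  move=> hs hc; rewrite -[2]/(1 + 1); apply: lerD; by rewrite exprn_ile1.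
have shift N : `|H%:R * avg c N - avg C N| <= 2 * H%:R * H%:R / N%:R.
  rewrite /avg mulrA -mulrBl normrM normfV normr_nat ler_wpM2r ?invr_ge0 //.
  rewrite /C exchange_big /= distrC.
  have -> : H%:R * \sum_(n < N) c n = \sum_(h < H) \sum_(n < N) c n.
    by rewrite sumr_const card_ord mulr_natl.
  rewrite -sumrB (le_trans (ler_norm_sum _ _ _)) //.
  have -> : 2 * H%:R * H%:R = \sum_(h < H) 2 * H%:R :> R.
    by rewrite sumr_const card_ord mulr_natr.
  apply: ler_sum => h _; rewrite -sumrB.
  apply: le_trans (sum_shift_bound h N c1) _.
  by rewrite mulr1 mulrC ler_wpM2l // ler_nat ltnW.
near=> N.
have N0 : 0 < N%:R :> R by rewrite ltr0n; near: N; exact: nbhs_infty_gt.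
have offN : \sum_(i | i.1 != i.2) avg (X i) N <= H%:R.
  have : `|0 - \sum_(i | i.1 != i.2) avg (X i) N| <= H%:R.
    by near: N; move/cvgrPdist_le: off; exact.
  by rewrite sub0r normrN; apply: le_trans; exact: ler_norm.
have HN : 2 * H%:R / N%:R <= e / 2.
  rewrite ler_pdivrMr // -ler_pdivrMl ?divr_gt0 //.
  by near: N; exact: nbhs_infty_ger.
have CS3 : avg (fun n => C n ^+ 2 + S n ^+ 2) N <= 3 * H%:R.
  rewrite (eq_avg _ CS) avg_sum (bigID (fun i => i.1 != i.2)) /=.
  by have := diag N; lra.
have CK : `|avg C N| <= 2 * K%:R.
  have CK n : `|C n| <= (2 * K%:R)^-1 * (C n ^+ 2 + S n ^+ 2) + K%:R / 2.
    rewrite -(ler_pM2l (_ : 0 < 2 * K%:R)) ?mulr_gt0 // mulrDr.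
    rewrite mulVKf ?mulf_neq0 ?gt_eqF //.
    have := sqr_ge0 (`|C n| - K%:R); have := sqr_ge0 (S n).
    by rewrite -(real_normK (num_real (C n))); nra.
  apply: (@le_trans _ _ (avg (fun n => `|C n|) N)).
    by rewrite /avg normrM normfV normr_nat ler_wpM2r ?invr_ge0 // ler_norm_sum.
  apply: le_trans (le_avg N CK) _.
  rewrite avgD avgZ avg_cst -?(ltr0n R) //.
  have KE : (2 * K%:R)^-1 * (3 * H%:R) + K%:R / 2 = 2 * K%:R :> R.
    by rewrite Hr; field; rewrite gt_eqF.
  by rewrite -[leRHS]KE lerD2r ler_wpM2l // invr_ge0 mulr_ge0 ?ltW.
have {shift} sh := shift N.
rewrite sub0r normrN -(ler_pM2l Hgt0) -{1}(ger0_norm (ltW Hgt0)) -normrM.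
have -> : H%:R * avg c N = (H%:R * avg c N - avg C N) + avg C N by ring.
apply: le_trans (ler_normD _ _) _.
have : 2 * H%:R * H%:R / N%:R <= H%:R * (e / 2) by rewrite mulrAC mulrC ler_wpM2l.
have : 2 * K%:R <= H%:R * (e / 2).
  rewrite Hr; move: Ke; rewrite ler_pdivrMr // => Ke.
  by have := ler_wpM2l (ltW K0r) Ke; lra.
lra.
Unshelve. all: by end_near. Qed.
End Averages.

(** * Weyl sums of polynomials with an irrational coefficient *)

Section WeylSums.
Context {R : realType}.
Implicit Types (x y : R) (P : {poly R}).

Definition cosp x := cos (pi *+ 2 * x).
Definition sinp x := sin (pi *+ 2 * x).

Lemma cosp_addz x (m : int) : cosp (x + m%:~R) = cosp x.
Proof.
have nat y (n : nat) : cosp (y + n%:R) = cosp y.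
  rewrite /cosp mulrDr mulr_natr; exact: (periodicn (@cosD2pi R)).
case: (intP m) => [|n|n]; first by rewrite addr0.
  exact: nat.
by rewrite mulrNz -[LHS](nat _ n.+1) subrK.
Qed.

Lemma sinp_addz x (m : int) : sinp (x + m%:~R) = sinp x.
Proof.
have nat y (n : nat) : sinp (y + n%:R) = sinp y.
  rewrite /sinp mulrDr mulr_natr; exact: (periodicn (@sinD2pi R)).
case: (intP m) => [|n|n]; first by rewrite addr0.
  exact: nat.
by rewrite mulrNz -[LHS](nat _ n.+1) subrK.
Qed.

Lemma cosp_le1 x : `|cosp x| <= 1. Proof. exact: cos_max. Qed.

Lemma sinp_le1 x : `|sinp x| <= 1. Proof. exact: sin_max. Qed.

Lemma cospD x y : cosp (x + y) = cosp x * cosp y - sinp x * sinp y.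
Proof. by rewrite /cosp mulrDr cosD. Qed.

Lemma cospB x y : cosp (x - y) = cosp x * cosp y + sinp x * sinp y.
Proof. by rewrite /cosp mulrBr cosB. Qed.

Lemma cospM x y : cosp x * cosp y = 2^-1 * (cosp (x + y) + cosp (x - y)).
Proof. by rewrite cospD cospB; field. Qed.

Lemma sin_cosp x y : 2 * sinp (y / 2) * cosp x = sinp (x + y / 2) - sinp (x - y / 2).
Proof. by rewrite /sinp /cosp mulrBr mulrDr sinB sinD; ring. Qed.

Lemma sqr_sinp_half x : sinp (x / 2) ^+ 2 = (1 - cosp x) / 2.
Proof.
have -> : cosp x = cos ((pi * x) *+ 2) by rewrite /cosp mulrnAl.
rewrite cos_mulr2n cos2sin2 (_ : pi * x = pi *+ 2 * (x / 2)); last by field.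
by rewrite -/(sinp _); field.
Qed.

Lemma sinp_half_gt0 x : 0 < x -> x < 1 -> 0 < sinp (x / 2).
Proof.
move=> x0 x1; rewrite /sinp (_ : pi *+ 2 * (x / 2) = pi * x); last by field.
have pi0 := pi_gt0 R; apply: sin_gt0_pi; apply/andP; split; first exact: mulr_gt0.
by rewrite -[ltRHS]mulr1 ltr_pM2l.
Qed.

(** [sinp (x / 2)] is sin (pi x). It changes sign under x + 1 but its square does not, so the
    reduction to the fractional part goes through [sqr_sinp_half]. *)
Lemma sinp_eq0 x : sinp (x / 2) = 0 -> exists m : int, x = m%:~R.
Proof.
move=> sx0; exists (Num.floor x).
pose y := x - (Num.floor x)%:~R.
have /andP[y0 y1] : 0 <= y < 1.
  have := floor_itv x; rewrite intrD /y => /andP[? ?].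
  by rewrite subr_ge0 ltrBlDr addrC; apply/andP.
apply/eqP; rewrite -subr_eq0 -/y; apply: contraT => yn0.
have /(sinp_half_gt0)/(_ y1)/(exprn_gt0 2) : 0 < y by rewrite lt_neqAle eq_sym yn0.
rewrite sqr_sinp_half -(cosp_addz y (Num.floor x)) subrK -sqr_sinp_half sx0.
by rewrite expr0n ltxx.
Qed.

Lemma irrational_sinp x : irrational x -> sinp (x / 2) != 0.
Proof.
move=> xirr; apply/eqP => /sinp_eq0[m xm]; apply: xirr; rewrite xm.
by exists m%:~R => //; rewrite ratr_int.
Qed.

Lemma rationalD x y : rational x -> rational y -> rational (x + y).
Proof. by move=> [p _ <-] [q _ <-]; exists (p + q) => //; rewrite rmorphD. Qed.

Lemma rationalM x y : rational x -> rational y -> rational (x * y).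
Proof. by move=> [p _ <-] [q _ <-]; exists (p * q) => //; rewrite rmorphM. Qed.

Lemma rationalV x : rational x -> rational x^-1.
Proof. by move=> [p _ <-]; exists p^-1 => //; rewrite fmorphV. Qed.

Lemma rational_nat (n : nat) : rational (n%:R : R).
Proof. by exists n%:R => //; rewrite ratr_nat. Qed.

Lemma rational_int (n : int) : rational (n%:~R : R).
Proof. by exists n%:~R => //; rewrite ratr_int. Qed.

Lemma rational_sum (I : Type) (r : seq I) (Q : pred I) (F : I -> R) :
  (forall i, Q i -> rational (F i)) -> rational (\sum_(i <- r | Q i) F i).
Proof.
move=> QF; elim/big_ind: _ => //; last exact: rationalD.
exact: (rational_nat 0).
Qed.

Lemma irrationalMD x y z :
  rational x -> x != 0 -> irrational y -> rational z -> irrational (x * y + z).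
Proof.
move=> xr x0 yi zr yr; apply: yi.
have -> : y = x^-1 * ((x * y + z) + (-1) * z) by field.
apply: rationalM; first exact: rationalV.
apply: rationalD => //; apply: rationalM => //.
exact: (rational_int (-1)).
Qed.

Lemma rational_denominator (s : seq R) : (forall x, x \in s -> rational x) ->
  exists2 q : nat, (0 < q)%N & forall x, x \in s -> exists m : int, q%:R * x = m%:~R.
Proof.
elim: s => [|a s IHs] ra; first by exists 1%N.
have [q q0 qs] : exists2 q : nat, (0 < q)%N &
    forall x, x \in s -> exists m : int, q%:R * x = m%:~R.
  by apply: IHs => x xs; apply: ra; rewrite inE xs orbT.
have /rationalP[n [b ab]] := ra _ (mem_head a s).
case: (posnP b) => [b0|b0].
  exists q => // x; rewrite inE => /orP[/eqP->|/qs//].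
  by exists 0; rewrite ab b0 invr0 !mulr0.
exists (b * q)%N; first by rewrite muln_gt0 q0 b0.
move=> x; rewrite inE natrM => /orP[/eqP->|/qs[m xm]].
  by exists (q%:Z * n); rewrite ab intrM; field; rewrite pnatr_eq0 -lt0n.
by exists (b%:Z * m); rewrite -mulrA xm intrM.
Qed.

Lemma rational_tail_period P (j : nat) :
  (forall i, (j < i)%N -> rational P`_i) ->
  exists2 q : nat, (0 < q)%N &
    forall i, (j < i)%N -> exists m : int, q%:R * P`_i = m%:~R.
Proof.
move=> Pr; have [|q q0 qP] := @rational_denominator [seq P`_i | i <- iota j.+1 (size P)].
  by move=> x /mapP[i]; rewrite mem_iota => /andP[ji _] ->; exact: Pr.
exists q => // i ji; case: (ltnP i (size P)) => iP.
  by apply: qP; apply: map_f; rewrite mem_iota ji ltn_addl.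
by exists 0; rewrite nth_default // mulr0.
Qed.

Lemma int_sum (I : Type) (r : seq I) (F : I -> R) :
  (forall i, exists m : int, F i = m%:~R) ->
  exists m : int, \sum_(i <- r) F i = m%:~R.
Proof.
move=> Fi; elim/big_ind: _ => //; first by exists 0.
by move=> _ _ [m ->] [n ->]; exists (m + n); rewrite intrD.
Qed.

(** As q divides (n + q)^i - n^i, the coefficients of index at least 2 contribute integers: modulo 1
    only the linear term sees the shift. *)
Lemma horner_addn_int P (q n : nat) :
  (forall i, (1 < i)%N -> exists m : int, q%:R * P`_i = m%:~R) ->
  exists m : int, P.[(n + q)%N%:R] = P.[n%:R] + q%:R * P`_1 + m%:~R.
Proof.
move=> qP.
have [m mE] : exists m : int,
    P.[(n + q)%N%:R] - P.[n%:R] - q%:R * P`_1 = m%:~R.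
  have s2 : (size P <= (size P).+2)%N by rewrite !leqW.
  rewrite !(horner_coef_wide _ s2) -sumrB !big_ord_recl /= !expr0 !expr1.
  rewrite /bump /= !add1n.
  have -> : P`_0 * 1 - P`_0 * 1 + (P`_1 * (n + q)%N%:R - P`_1 * n%:R +
      \sum_(i < size P) (P`_(i.+2) * (n + q)%N%:R ^+ i.+2 - P`_(i.+2) * n%:R ^+ i.+2)) -
      q%:R * P`_1 =
      \sum_(i < size P) (P`_(i.+2) * (n + q)%N%:R ^+ i.+2 - P`_(i.+2) * n%:R ^+ i.+2).
    by rewrite natrD; ring.
  apply: int_sum => i.
  have [m mE] := qP i.+2 isT.
  have [t tE] : exists t : nat, ((n + q) ^ i.+2 = n ^ i.+2 + t * q)%N.
    have : (n + q) ^ i.+2 = n ^ i.+2 %[mod q] by rewrite -modnXm modnDr modnXm.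
    move/eqP; rewrite eqn_mod_dvd ?leq_exp2r ?leq_addr // => /dvdnP[t tE].
    by exists t; rewrite -tE subnKC // leq_exp2r // leq_addr.
  exists (m * t%:Z); rewrite -!natrX tE natrD natrM intrM -mE; ring.
by exists m; rewrite -mE; ring.
Qed.

(** Modulo 1, a shift by q adds the constant [phi] to P(n). Hence 2 sin (pi phi) cosp P(n) is a
    difference of step q, and the whole sum stays bounded; irrationality of [phi] makes the factor
    non-zero. *)
Lemma weyl_sum_base P :
  irrational P`_1 -> (forall i, (1 < i)%N -> rational P`_i) ->
  avg (fun n => cosp P.[n%:R]) @ \oo --> (0 : R).
Proof.
move=> P1 Pr; have [q q0 qP] := rational_tail_period Pr.
pose phi := q%:R * P`_1.
have phi_irr : irrational phi.
  rewrite -[phi]addr0; apply: irrationalMD => //; try exact: rational_nat.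
    by rewrite pnatr_eq0 -lt0n.
  exact: (rational_nat 0).
have s0 := irrational_sinp phi_irr.
pose F n := sinp (P.[n%:R] - phi / 2).
have FE n : 2 * sinp (phi / 2) * cosp P.[n%:R] = F (n + q)%N - F n.
  rewrite sin_cosp; congr (_ - _); rewrite /F.
  have [m ->] := horner_addn_int n qP.
  by rewrite -[LHS](sinp_addz _ m); congr sinp; rewrite -/phi; field.
rewrite (_ : avg _ = fun N => (2 * sinp (phi / 2))^-1 * ((\sum_(n < N) (F (n + q)%N - F n)) / N%:R)); last first.
  apply/funext => N; rewrite /avg mulrA mulr_sumr; congr (_ / _).
  by apply: eq_bigr => n _; rewrite -FE mulKf // mulf_neq0.
rewrite -[X in _ --> X](mulr0 (2 * sinp (phi / 2))^-1).
apply: cvgMr.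
apply: (@squeeze_cvgr _ _ _ _ (fun N => - (q%:R * (2 * 1) / N%:R)) (fun N => q%:R * (2 * 1) / N%:R)).
- apply: nearW => N; rewrite -ler_norml normrM normfV normr_nat.
  rewrite ler_wpM2r ?invr_ge0 //; apply: sum_shift_bound => n; exact: sinp_le1.
- by rewrite -[X in _ --> X]oppr0; apply: cvgN; exact: cvg_invn.
- exact: cvg_invn.
Qed.

Lemma coef_shift P (a i S : nat) : (size P <= S)%N ->
  (P \Po ('X + a%:R%:P))`_i = \sum_(k < S) P`_k * (a%:R ^+ (k - i) *+ 'C(k, i)).
Proof.
move=> PS; rewrite /comp_poly (@horner_coef_wide _ S) ?size_map_polyC //.
rewrite coef_sum; apply: eq_bigr => k _; rewrite coef_map /= coefCM; congr (_ * _).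
rewrite addrC exprDn coef_sum.
rewrite (eq_bigr (fun l : 'I_k.+1 => if l == i :> nat then a%:R ^+ (k - l) *+ 'C(k, l) else 0)); last first.
  move=> l _; rewrite coefMn -polyC_exp coefCM coefXn eq_sym.
  by case: eqP => _; rewrite ?mulr1 // mulr0 mul0rn.
rewrite -big_mkcond /=; case: (ltnP i k.+1) => ik.
  by rewrite (big_pred1 (Ordinal ik)).
rewrite bin_small // mulr0n big1 // => l /eqP li.
by move: ik; rewrite -li ltnNge -ltnS ltn_ord.
Qed.

(* The difference of two shifts of P lowers the index of the last irrational
   coefficient by one. *)
Lemma weyl_sum P (j : nat) :
  irrational P`_j.+1 -> (forall i, (j.+1 < i)%N -> rational P`_i) ->
  avg (fun n => cosp P.[n%:R]) @ \oo --> (0 : R).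
Proof.
elim: j P => [|j IHj] P Pj Pr; first exact: weyl_sum_base.
apply: (@van_der_corput _ _ (fun n => sinp P.[n%:R])) => [n|n|h h' hh'].
- exact: cosp_le1.
- exact: sinp_le1.
pose sh (a : nat) := P \Po ('X + a%:R%:P).
rewrite (_ : avg _ = avg (fun n => cosp (sh h - sh h').[n%:R])); last first.
  apply/funext => N; apply: eq_avg => n.
  by rewrite hornerD hornerN !horner_comp !hornerE cospB !natrD.
pose S := maxn (size P) j.+3.
pose D (i k : nat) : R := (h%:R ^+ (k - i) - h'%:R ^+ (k - i)) *+ 'C(k, i).
have shE i : (sh h - sh h')`_i = \sum_(k < S) P`_k * D i k.
  rewrite coefB !(@coef_shift _ _ _ S) ?leq_maxl // -sumrB.
  by apply: eq_bigr => k _; rewrite /D mulrnBl mulrBr.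
have D0 (i k : nat) : (k <= i)%N -> D i k = 0.
  rewrite leq_eqVlt => /orP[/eqP->|ki]; first by rewrite /D subnn subrr mul0rn.
  by rewrite /D bin_small.
have Dr (i k : nat) : rational (D i k).
  exists ((h%:R ^+ (k - i) - h'%:R ^+ (k - i)) *+ 'C(k, i)) => //.
  by rewrite rmorphMn rmorphB !rmorphXn /= !ratr_nat.
have tail i k : (j.+1 <= i)%N -> k != j.+2 \/ i != j.+1 -> rational (P`_k * D i k).
  move=> ji ki; case: (leqP k i) => [ki'|ik].
    by rewrite (D0 _ _ ki') mulr0; exact: (rational_nat 0).
  apply: rationalM => //; apply: Pr; rewrite ltn_neqAle (leq_ltn_trans ji ik) andbT.
  case: ki => [|ij]; first by rewrite eq_sym.
  rewrite neq_ltn (leq_trans _ ik) // ltnS ltn_neqAle ji andbT eq_sym.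
  by [].
apply: IHj => [|i ji].
(* In the coefficient of index j + 1, the term k = j + 2 is (j + 2) (h - h') times the irrational
   coefficient of P, and all other terms are rational. *)
- have jS : (j.+2 < S)%N by rewrite leq_maxr.
  rewrite shE (bigD1 (Ordinal jS)) //= mulrC; apply: irrationalMD => //.
  + rewrite /D subSnn !expr1 binSn.
    rewrite mulrn_eq0 negb_or /= subr_eq0 eqr_nat.
    by rewrite hh'.
  + apply: rational_sum => k kj; apply: tail => //; left.
    by move: kj; apply: contraNN => /eqP kE; apply/eqP/val_inj.
- rewrite shE; apply: rational_sum => k _; apply: tail; first exact: ltnW.
  by right; rewrite gtn_eqF.
Qed.

Lemma weyl_sum_irrational P :
  (exists j : nat, (0 < j)%N /\ irrational P`_j) ->
  avg (fun n => cosp P.[n%:R]) @ \oo --> (0 : R).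
Proof.
move=> Pirr.
pose p (j : nat) := (0 < j)%N && `[< irrational P`_j >].
have exp : exists j, p j by case: Pirr => j [j0 jP]; exists j; rewrite /p j0; apply/asboolP.
have pS j : p j -> (j <= size P)%N.
  move=> /andP[_ /asboolP jP]; rewrite leqNgt; apply/negP => sj; apply: jP.
  by rewrite nth_default; [exact: (rational_nat 0) | exact: ltnW].
have [j /andP[j0 /asboolP jP] jmax] := ex_maxnP exp pS.
case: j j0 jP jmax => // j _ jP jmax.
apply: (weyl_sum jP) => i ji; apply: contrapT => iP.
have := jmax i; rewrite /p (leq_trans _ ji) //= leqNgt ji /= => /(_ _)/negP; apply.
  by apply/asboolP.
by [].
Qed.
End WeylSums.

(** * The Fejér kernel on a finite grid *)

Section Fejer.
Context {R : realType}.
Implicit Types (x y d : R) (M : nat).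

(** This is (sin (pi M x) / (M sin (pi x)))^2, the usual Fejér kernel divided by M, so that its mean
    over a period is 1 / M. *)
Definition fejer M x : R :=
  ((\sum_(a < M) cosp (a%:R * x)) ^+ 2 + (\sum_(a < M) sinp (a%:R * x)) ^+ 2)
    / M%:R ^+ 2.

Lemma fejer_ge0 M x : 0 <= fejer M x.
Proof. by rewrite divr_ge0 ?exprn_ge0 // addr_ge0 // sqr_ge0. Qed.

Lemma fejerE M x :
  fejer M x = \sum_(p : 'I_M * 'I_M) (M%:R ^+ 2)^-1 * cosp ((p.1%:Z - p.2%:Z)%:~R * x).
Proof.
rewrite -mulr_sumr mulrC; congr (_ * _).
rewrite -(pair_bigA _ (fun i j : 'I_M => cosp ((i%:Z - j%:Z)%:~R * x))) /=.
rewrite !expr2 !mulr_suml -big_split; apply: eq_bigr => i _ /=.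
rewrite !mulr_sumr -big_split; apply: eq_bigr => j _ /=.
by rewrite -cospB intrB mulrBl.
Qed.

Lemma fejerN M x : fejer M (- x) = fejer M x.
Proof.
rewrite /fejer; congr ((_ ^+ 2 + _) / _).
  by apply: eq_bigr => a _; rewrite /cosp !mulrN cosN.
rewrite -[in RHS]sqrrN -sumrN; congr (_ ^+ 2); apply: eq_bigr => a _.
by rewrite /sinp !mulrN sinN.
Qed.

(** A geometric sum over roots of unity, in real form: multiplied by 2 sin (pi r / M) it telescopes
    to a difference over r full periods. The factor is non-zero because 0 < |r| < M. *)
Lemma sum_cosp_roots M (r : int) (x : R) : (0 < M)%N -> r != 0 -> (`|r| < M)%N ->
  \sum_(j < M) cosp (r%:~R * (x - j%:R / M%:R)) = 0.
Proof.
move=> M0 r0 rM.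
have Mr : M%:R != 0 :> R by rewrite pnatr_eq0 -lt0n.
pose y : R := r%:~R / M%:R.
have sy : sinp (y / 2) != 0.
  apply/eqP => /sinp_eq0[m ym].
  have : r = m * M%:Z.
    by apply: (@intr_inj R); rewrite intrM -ym /y /= mulfVK.
  move=> rE; move: rM r0; rewrite rE abszM absz_nat -[X in (_ < X)%N]mul1n ltn_pmul2r //.
  by rewrite ltnS leqn0 absz_eq0 => /eqP ->; rewrite mul0r eqxx.
apply: (@mulfI _ (2 * sinp (y / 2))); first by rewrite mulf_neq0.
rewrite mulr0 mulr_sumr.
pose G (j : nat) := sinp (r%:~R * x - j%:R * y + y / 2).
rewrite (eq_bigr (fun j : 'I_M => - (G j.+1 - G j))); last first.
  move=> j _; rewrite sin_cosp opprB /G -natr1; congr (sinp _ - sinp _).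
    by rewrite /y; field.
  by rewrite /y; field.
rewrite sumrN -(big_mkord xpredT (fun j => G j.+1 - G j)) telescope_sumr // /G.
rewrite mul0r subr0 -[X in sinp (_ - X + _)]mulrC /y mulfVK //.
rewrite -[sinp (r%:~R * x - _ + _)](sinp_addz _ r) addrAC subrK.
by rewrite subrr oppr0.
Qed.

(* Exactness on the grid j / M replaces the convolution with the kernel, so that
   no integral is needed. *)
Lemma sum_fejer M x : (0 < M)%N -> \sum_(j < M) fejer M (x - j%:R / M%:R) = 1.
Proof.
move=> M0; have Mr : M%:R != 0 :> R by rewrite pnatr_eq0 -lt0n.
under eq_bigr do rewrite fejerE.
rewrite exchange_big /= (bigID (fun p => p.2 == p.1)) /= [X in _ + X]big1 ?addr0; last first.
  move=> p pp; rewrite -mulr_sumr sum_cosp_roots ?mulr0 //.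
    by rewrite subr_eq0 eqz_nat eq_sym.
  have := ltn_ord p.1; have := ltn_ord p.2; lia.
rewrite (eq_bigr (fun=> M%:R^-1)); last first.
  move=> p /eqP pp; rewrite (eq_bigr (fun=> (M%:R ^+ 2)^-1)).
    by rewrite sumr_const card_ord -mulr_natl; field.
  by move=> j _; rewrite pp subrr mul0r /cosp mulr0 cos0 mulr1.
rewrite (eq_bigl (fun p : 'I_M * 'I_M => xpredT p.1 && (p.2 == p.1))) //.
rewrite -(pair_big_dep xpredT (fun i j : 'I_M => j == i) (fun _ _ => M%:R^-1)) /=.
rewrite (eq_bigr (fun=> M%:R^-1)); last by move=> i _; rewrite big_pred1_eq.
by rewrite sumr_const card_ord -[LHS]mulr_natl divff.
Qed.

(** The cosine and sine sums are bounded separately by telescoping, each contributing 1; this is the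
    origin of the constant 2. *)
Lemma fejer_le M x : (0 < M)%N -> sinp (x / 2) != 0 ->
  fejer M x <= 2 / (M%:R ^+ 2 * sinp (x / 2) ^+ 2).
Proof.
move=> M0 s0; have Mr : 0 < M%:R :> R by rewrite ltr0n.
have s2 : 0 < sinp (x / 2) ^+ 2 by rewrite exprn_even_gt0.
have bound (F : nat -> R) u : (forall n, `|F n| <= 1) ->
    2 * sinp (x / 2) * u = F M - F 0 -> u ^+ 2 * sinp (x / 2) ^+ 2 <= 1.
  move=> F1 uE.
  have : `|2 * sinp (x / 2) * u| <= 2.
    by rewrite uE (le_trans (ler_normB _ _)) // -[leRHS]/(1 + 1) lerD.
  rewrite -mulrA normrM ger0_norm // -ler_pdivlMl // mulVf // => u1.
  by rewrite mulrC -exprMn -(real_normK (num_real _)) exprn_ile1.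
have cb : (\sum_(a < M) cosp (a%:R * x)) ^+ 2 * sinp (x / 2) ^+ 2 <= 1.
  apply: (bound (fun a => sinp (a%:R * x - x / 2))) => [n|]; first exact: sinp_le1.
  rewrite mulr_sumr -(telescope_sumr (fun a => sinp (a%:R * x - x / 2))) // big_mkord.
  apply: eq_bigr => a _; rewrite sin_cosp -natr1; congr (sinp _ - sinp _).
  by field.
have sb : (\sum_(a < M) sinp (a%:R * x)) ^+ 2 * sinp (x / 2) ^+ 2 <= 1.
  apply: (bound (fun a => - cosp (a%:R * x - x / 2))) => [n|].
    by rewrite normrN cosp_le1.
  rewrite mulr_sumr -(telescope_sumr (fun a => - cosp (a%:R * x - x / 2))) // big_mkord.
  apply: eq_bigr => a _; rewrite -[a.+1%:R]natr1.
  rewrite (_ : (a%:R + 1) * x - x / 2 = a%:R * x + x / 2); last by field.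
  by rewrite cospB cospD; ring.
move: (sinp (x / 2) ^+ 2) s2 cb sb => S S0 cb sb.
rewrite (_ : 2 / _ = 2 / S / M%:R ^+ 2); last by field; rewrite !gt_eqF.
rewrite /fejer ler_wpM2r ?invr_ge0 ?exprn_ge0 //.
by rewrite ler_pdivlMr // mulrDl; exact: (lerD cb sb).
Qed.

Lemma cosp_le d x : 0 < d -> d <= x -> x <= 1 - d -> cosp x <= cosp d.
Proof.
have pi0 := pi_gt0 R.
have half y : d <= y -> y <= 2^-1 -> 0 < d -> cosp y <= cosp d.
  move=> dy y2 d0; rewrite /cosp.
  have h z : 0 <= z -> z <= 2^-1 -> (pi *+ 2 * z : R) \in `[0, pi].
    by move=> z0 z2; rewrite in_itv /=; apply/andP; split; nra.
  move: dy; rewrite le_eqVlt => /orP[/eqP->//|dy].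
  have hy := h y (ltW (lt_trans d0 dy)) y2.
  have hd := h d (ltW d0) (ltW (lt_le_trans dy y2)).
  by rewrite ltW // ltr_cos // ltr_pM2l // pmulrn_lgt0.
move=> d0 dx xd; have [x2|x2] := leP x 2^-1; first exact: half.
have -> : cosp x = cosp (1 - x).
  by rewrite /cosp mulrBr mulr1 addrC (@cosD2pi R) cosN.
by apply: half => //; lra.
Qed.

Lemma fejer_far M d x : (0 < M)%N -> 0 < d -> d <= x -> x <= 1 - d ->
  fejer M x <= 2 / (M%:R ^+ 2 * sinp (d / 2) ^+ 2).
Proof.
move=> M0 d0 dx xd; have Mr : 0 < M%:R :> R by rewrite ltr0n.
have sd : 0 < sinp (d / 2) ^+ 2.
  by rewrite exprn_gt0 // sinp_half_gt0 //; lra.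
have le_s : sinp (d / 2) ^+ 2 <= sinp (x / 2) ^+ 2.
  by rewrite !sqr_sinp_half; have := cosp_le d0 dx xd; lra.
apply: le_trans (fejer_le M0 _) _.
  by rewrite -sqrf_eq0 gt_eqF // (lt_le_trans sd).
have M2 : 0 < M%:R ^+ 2 :> R by rewrite exprn_gt0.
have p1 := mulr_gt0 M2 sd; have p2 := mulr_gt0 M2 (lt_le_trans sd le_s).
by rewrite ler_pM2l // lef_pV2 ?posrE // ler_pM2l.
Qed.

(** A trigonometric polynomial of mean J / M that stands for the indicator of [0, J / M) modulo
    1. *)
Definition bump (M J : nat) x := \sum_(j < J) fejer M (x - j%:R / M%:R).

(* Grid points j / M with j >= t + 2r stay at distance at least r / M from x
   modulo 1. *)
Lemma bump_lower M (r t : nat) x : (0 < r)%N -> (r <= M)%N ->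
  r%:R / M%:R <= x -> x < (r + t)%N%:R / M%:R ->
  1 - 2 / (M%:R * sinp (r%:R / M%:R / 2) ^+ 2) <= bump M (minn (t + 2 * r) M) x.
Proof.
move=> r0 rM rx xr; have M0 : (0 < M)%N by exact: leq_trans rM.
have Mr : 0 < M%:R :> R by rewrite ltr0n.
set J := minn _ _; have JM : (J <= M)%N by rewrite geq_minr.
rewrite lerBlDr -[leLHS](sum_fejer x M0) /bump.
rewrite -!(big_mkord xpredT (fun j => fejer M (x - j%:R / M%:R))).
rewrite (@big_cat_nat _ _ _ J) //= lerD2l.
have -> : 2 / (M%:R * sinp (r%:R / M%:R / 2) ^+ 2) =
    \sum_(0 <= j < M) 2 / (M%:R ^+ 2 * sinp (r%:R / M%:R / 2) ^+ 2) :> R.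
  rewrite big_mkord sumr_const card_ord -[RHS]mulr_natl.
  move: (sinp _ ^+ 2) => S; rewrite !invfM.
  by move: S^-1 => v; field; rewrite gt_eqF.
rewrite [leRHS](@big_cat_nat _ _ _ J) //= -[leLHS]add0r lerD //.
  by rewrite sumr_ge0 // => j _; rewrite divr_ge0 // mulr_ge0 // sqr_ge0.
rewrite !big_nat; apply: ler_sum => j /andP[Jj jM].
rewrite -fejerN opprB; apply: fejer_far => //.
- by rewrite divr_gt0 ?ltr0n.
- have : (t + 2 * r <= j)%N by move: Jj; rewrite /J geq_min [(M <= j)%N]leqNgt jM orbF.
  rewrite -(ler_nat R) lerBrDr => tj.
  have : x + r%:R / M%:R <= (t + 2 * r)%N%:R / M%:R.
    have -> : (t + 2 * r)%N%:R / M%:R = (r + t)%N%:R / M%:R + r%:R / M%:R :> R.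
      by rewrite -mulrDl -natrD; congr (_%:R / _); lia.
    by rewrite lerD2r ltW.
  rewrite addrC => /le_trans; apply; by rewrite ler_wpM2r ?invr_ge0.
- apply: lerB => //; rewrite ler_pdivrMr // mul1r ler_nat; exact: ltnW.
Qed.
End Fejer.

(** * Joint equidistribution modulo 1 and residues of floors *)

Section Equidistribution.
Context {R : realType} {k : nat}.
Implicit Types (g f : 'I_k -> nat -> R) (h : 'I_k -> int).

(** Weyl's criterion in real form: th = 0 and th = -1/4 give the real and imaginary parts of the
    exponential averages. *)
Definition weyl_indep g := forall h, (exists i, h i != 0) -> forall th : R,
  avg (fun n => cosp (\sum_i (h i)%:~R * g i n + th)) @ \oo --> (0 : R).

Section TrigProduct.
Context {I : finType}.
Context (g : 'I_k -> nat -> R) (gW : weyl_indep g).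
Context (w : I -> R) (a : I -> int) (b : I -> R).

Let trig (x : R) := \sum_t w t * cosp ((a t)%:~R * x + b t).
Let mean := \sum_(t | a t == 0) w t * cosp (b t).

(** Means of trigonometric polynomials multiply. The extra cosine closes the induction: by the
    product-to-sum formula, peeling off the factor i adds the frequency [a t] or its opposite at
    coordinate i of [h]. That coordinate was 0, so nothing cancels and only zero frequencies
    survive. *)
Lemma avg_trig_prod (r : seq 'I_k) h (th : R) : uniq r ->
  (forall i, i \in r -> h i = 0) ->
  avg (fun n => (\prod_(i <- r) trig (g i n)) *
                cosp (\sum_i (h i)%:~R * g i n + th)) @ \oo -->
  mean ^+ size r * (if [forall i, h i == 0] then cosp th else 0).
Proof.
elim: r h th => [|i r IHr] h th /=.
  move=> _ _; rewrite mul1r.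
  rewrite (_ : avg _ = avg (fun n => cosp (\sum_i (h i)%:~R * g i n + th))); last first.
    by apply/funext => N; apply: eq_avg => n; rewrite big_nil mul1r.
  case: ifPn => [/forallP h0|].
    rewrite (_ : avg _ = avg (fun=> cosp th)); first exact: cvg_avg_cst.
    apply/funext => N; apply: eq_avg => n; rewrite big1 ?add0r // => i _.
    by rewrite (eqP (h0 i)) mul0r.
  by rewrite negb_forall => /existsP h0; apply: gW.
move=> /andP[ir ur] hr.
have hi : h i = 0 by apply: hr; rewrite mem_head.
pose h' (s : int) (t : I) j := h j + (if j == i then s * a t else 0).
have h'E s t n th' : \sum_j (h' s t j)%:~R * g j n + th' =
    \sum_j (h j)%:~R * g j n + (s * a t)%:~R * g i n + th'.
  congr (_ + _); rewrite (bigD1 i) //= [in RHS](bigD1 i) //= /h' eqxx hi add0r mul0r.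
  rewrite add0r [RHS]addrC; congr (_ + _); apply: eq_bigr => j ji.
  by rewrite (negbTE ji) addr0.
pose v (s : int) t n := (\prod_(j <- r) trig (g j n)) *
  cosp (\sum_j (h' s t j)%:~R * g j n + (th + s%:~R * b t)).
have -> : avg (fun n => (\prod_(j <- i :: r) trig (g j n)) *
      cosp (\sum_j (h j)%:~R * g j n + th)) =
    (fun N => \sum_t w t * (2^-1 * (avg (v 1 t) N + avg (v (-1) t) N))).
  apply/funext => N.
  under [RHS]eq_bigr do rewrite -avgD -avgZ -avgZ.
  rewrite -avg_sum; apply: eq_avg => n.
  rewrite big_cons /v; set P := \prod_(j <- r) _.
  rewrite {1}/trig !mulr_suml; apply: eq_bigr => t _; rewrite !h'E.
  rewrite [LHS](_ : _ = w t * (P * (cosp (\sum_j (h j)%:~R * g j n + th) *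
    cosp ((a t)%:~R * g i n + b t)))); last by ring.
  rewrite cospM; congr (w t * _); rewrite mulrCA -mulrDr.
  by congr (_ * (_ * (cosp _ + cosp _))); rewrite ?mul1r ?mulN1r ?mulrNz; ring.
have r0 s t : forall j, j \in r -> h' s t j = 0.
  move=> j jr; rewrite /h' hr ?inE ?jr ?orbT // add0r ifN //.
  by apply: contraNN ir => /eqP <-.
have lim s t : avg (v s t) @ \oo --> mean ^+ size r *
    (if [forall j, h' s t j == 0] then cosp (th + s%:~R * b t) else 0).
  by apply: IHr => //; exact: r0.
have h'0 s t : s != 0 -> [forall j, h' s t j == 0] = [forall j, h j == 0] && (a t == 0).
  move=> s0; apply/forallP/andP => [h0|[/forallP h0 /eqP a0] j]; last first.
    by rewrite /h' (eqP (h0 j)) a0 mulr0 if_same.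
  split.
    apply/forallP => j; have := h0 j; rewrite /h'; case: (j =P i) => [->|_]; last by rewrite addr0.
    by rewrite hi.
  by have := h0 i; rewrite /h' eqxx hi add0r mulf_eq0 (negbTE s0).
have -> : mean ^+ (size r).+1 * (if [forall j, h j == 0] then cosp th else 0) =
    \sum_t w t * (2^-1 * (mean ^+ size r *
      (if [forall j, h' 1 t j == 0] then cosp (th + 1%:~R * b t) else 0) +
      mean ^+ size r *
      (if [forall j, h' (-1) t j == 0] then cosp (th + (-1)%:~R * b t) else 0))).
  under eq_bigr do rewrite !h'0 //.
  case: ifP => _ /=; last by rewrite mulr0 big1 // => t _; rewrite mulr0 addr0 !mulr0.
  rewrite exprS -mulrA mulrC {2}/mean [in LHS]big_mkcond mulr_sumr.
  apply: eq_bigr => t _; case: ifP => _; last by rewrite !(mulr0, addr0).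
  (* Half the sum of cosp (th + b) and cosp (th - b) is cosp th * cosp b, so each zero frequency
     contributes its term of [mean]. *)
  by rewrite mulrNz mulN1r mul1r cospD cospB; field.
apply: cvg_sumr => t _; apply: cvgMr; apply: cvgMr; apply: cvgD; exact: lim.
Qed.
End TrigProduct.

Lemma avg_bump_prod g (M J : nat) : weyl_indep g -> (0 < M)%N ->
  avg (fun n => \prod_i bump M J (g i n)) @ \oo --> (J%:R / M%:R : R) ^+ k.
Proof.
move=> gW M0; have Mr : M%:R != 0 :> R by rewrite pnatr_eq0 -lt0n.
pose T := ('I_J * ('I_M * 'I_M))%type.
pose w (t : T) : R := (M%:R ^+ 2)^-1.
pose a (t : T) := t.2.1%:Z - t.2.2%:Z.
pose b (t : T) : R := - ((a t)%:~R * (t.1%:R / M%:R)).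
have bE x : bump M J x = \sum_t w t * cosp ((a t)%:~R * x + b t).
  rewrite /bump; under eq_bigr do rewrite fejerE.
  rewrite pair_bigA /=; apply: eq_bigr => -[j p] _ /=.
  by rewrite /b /a /= mulrBr.
(* Frequency zero means equal indices in the double sum of the kernel: J M terms of weight 1 / M^2,
   all with phase 0. *)
have mE : \sum_(t : T | a t == 0) w t * cosp (b t) = J%:R / M%:R.
  rewrite (eq_bigr (fun=> (M%:R ^+ 2)^-1)); last first.
    by move=> t /eqP a0; rewrite /b a0 mul0r oppr0 /cosp mulr0 cos0 mulr1.
  rewrite (eq_bigl (fun t : T => xpredT t.1 && (t.2.2 == t.2.1))); last first.
    by move=> t; rewrite /a subr_eq0 eqz_nat eq_sym.
  rewrite -(pair_big_dep xpredT (fun (j : 'I_J) (p : 'I_M * 'I_M) => p.2 == p.1)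
    (fun _ _ => (M%:R ^+ 2)^-1)) /=.
  rewrite sumr_const card_ord -[LHS]mulr_natl; congr (_ * _).
  rewrite (eq_bigl (fun p : 'I_M * 'I_M => xpredT p.1 && (p.2 == p.1))) //.
  rewrite -(pair_big_dep xpredT (fun i j : 'I_M => j == i) (fun _ _ => (M%:R ^+ 2)^-1)) /=.
  rewrite (eq_bigr (fun=> (M%:R ^+ 2)^-1)); last by move=> i _; rewrite big_pred1_eq.
  by rewrite sumr_const card_ord -[LHS]mulr_natl; field.
have := @avg_trig_prod T g gW w a b (enum 'I_k) (fun=> 0) 0 (enum_uniq _) (fun _ _ => erefl).
rewrite mE size_enum_ord.
have -> : [forall i : 'I_k, (0 : int) == 0] by apply/forallP.
have c0 : cosp 0 = 1 :> R by rewrite /cosp mulr0 cos0.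
rewrite c0 mulr1.
set u := (X in X @ \oo --> _ -> _) => ul.
rewrite (_ : avg _ = u) //; apply/funext => N; apply: eq_avg => n.
rewrite addr0 [X in cosp X]big1 ?c0 ?mulr1; last by move=> i _; rewrite mul0r.
rewrite big_enum /=.
by apply: eq_bigr => i _; rewrite bE.
Qed.

Lemma weyl_indep_shift g (c : 'I_k -> R) :
  weyl_indep g -> weyl_indep (fun i n => g i n + c i).
Proof.
move=> gW h h0 th.
have := gW h h0 (\sum_i (h i)%:~R * c i + th).
rewrite (_ : avg _ = avg (fun n => cosp (\sum_i (h i)%:~R * (g i n + c i) + th))) //.
apply/funext => N; apply: eq_avg => n; congr cosp; rewrite addrA -big_split.
by congr (_ + _); apply: eq_bigr => i _; rewrite mulrDr.
Qed.

Lemma bump_addz (M J : nat) (x : R) (m : int) : bump M J (x + m%:~R) = bump M J x.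
Proof.
have am (a : nat) : a%:R * m%:~R = (a%:Z * m)%:~R :> R by rewrite intrM.
apply: eq_bigr => j _; rewrite addrAC /fejer; congr ((_ ^+ 2 + _ ^+ 2) / _).
  by apply: eq_bigr => a _; rewrite mulrDr am cosp_addz.
by apply: eq_bigr => a _; rewrite mulrDr am sinp_addz.
Qed.

Lemma bump_ge0 (M J : nat) (x : R) : 0 <= bump M J x.
Proof. by rewrite sumr_ge0 // => j _; exact: fejer_ge0. Qed.

Definition fracpart (x : R) : R := x - (Num.floor x)%:~R.

(** The indicator of the box is majorised by a product of bumps of width at most [c D], slightly
    above 1 / d. Each bump is at least [c D / w] on the box, so after rescaling the majorant has
    mean at most w^k, where w > 1 / d is chosen with w^k below the target. *)
Lemma box_upper g (d : nat) (e : R) : weyl_indep g -> (0 < d)%N -> 0 < e ->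
  \forall N \near \oo,
    avg (fun n => [forall i, fracpart (g i n) < d%:R^-1]%:R) N <= d%:R^-1 ^+ k + e.
Proof.
move=> gW d0 e0; have dr : 0 < d%:R :> R by rewrite ltr0n.
have [w dw we] : exists2 w : R, d%:R^-1 < w & w ^+ k < d%:R^-1 ^+ k + e.
  have : \forall x \near (d%:R^-1 : R)^'+, x ^+ k < d%:R^-1 ^+ k + e.
    have : (fun x : R => x ^+ k) @ (d%:R^-1 : R)^'+ --> (d%:R^-1 : R) ^+ k.
      by apply: cvg_at_right_filter; exact: exprn_continuous.
    by move/cvgr_lt => /(_ (d%:R^-1 ^+ k + e)); apply; rewrite ltrDl.
  move=> nw; near ((d%:R^-1 : R)^'+) => w; exists w; first by near: w; exact: nbhs_right_gt.
  by near: w.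
have w0 : 0 < w by rewrite (lt_trans _ dw) ?invr_gt0.
pose c (D : nat) := d%:R^-1 + 2 / D%:R : R.
have [D D1 Dw] : exists2 D : nat, (1 < D)%N & c D < w.
  exists (Num.truncn (2 / (w - d%:R^-1))).+2 => //.
  rewrite /c -ltrBrDl ltr_pdivrMr ?ltr0n // mulrC -ltr_pdivrMr ?subr_gt0 //.
  by apply: lt_trans (truncnS_gt _) _; rewrite ltr_nat.
have Dr : 0 < D%:R :> R by rewrite ltr0n ltnW.
have c0 : 0 < c D by rewrite addr_gt0 ?invr_gt0 ?divr_gt0.
pose s := sinp (D%:R^-1 / 2) ^+ 2 : R.
have s0 : 0 < s.
  by rewrite exprn_gt0 // sinp_half_gt0 ?invr_gt0 // invf_lt1 // ltr1n.
have cw : c D / w < 1 by rewrite ltr_pdivrMr // mul1r.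
have [u u0 ueta] : exists2 u : nat, (0 < u)%N & 2 / (u%:R * s) <= 1 - c D / w.
  exists (Num.truncn (2 / ((1 - c D / w) * s))).+1 => //.
  have cs : 0 < (1 - c D / w) * s by rewrite mulr_gt0 // subr_gt0.
  rewrite ler_pdivrMr; last by rewrite mulr_gt0 // ltr0n.
  rewrite mulrCA -ler_pdivrMr //.
  by rewrite ltW // truncnS_gt.
have ur : 0 < u%:R :> R by rewrite ltr0n.
(* With this grid, 1 / d and 1 / D are the multiples t / M and r / M. The bump has a margin 1 / D on
   each side, whence the 2 / D in [c]; u makes the kernel's error at most 1 - c D / w. *)
pose M := (d * D * u)%N; pose r := (d * u)%N; pose t := (D * u)%N.
have M0 : (0 < M)%N by rewrite !muln_gt0 d0 u0 ltnW.
have Mr : 0 < M%:R :> R by rewrite ltr0n.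
have rM : r%:R / M%:R = D%:R^-1 :> R.
  by rewrite !natrM; field; rewrite !gt_eqF.
have tM : t%:R / M%:R = d%:R^-1 :> R.
  by rewrite !natrM; field; rewrite !gt_eqF.
pose J := minn (t + 2 * r) M.
have JM : J%:R / M%:R <= c D.
  rewrite /c -rM -tM ler_pdivrMr // mulrDl mulrA !divfK ?gt_eqF //.
  by rewrite -natrM -natrD ler_nat geq_minl.
(* The shift by 1 / D moves the box past the left margin of the bump. *)
pose g' i n := g i n + D%:R^-1.
have lower n : [forall i, fracpart (g i n) < d%:R^-1]%:R <=
    (w / c D) ^+ k * \prod_i bump M J (g' i n).
  case: (boolP [forall i, _]) => [/forallP fg|_] /=; last first.
    apply: mulr_ge0; first by rewrite exprn_ge0 // ltW // divr_gt0.
    by apply: prodr_ge0 => i _; exact: bump_ge0.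
  rewrite mulrC -ler_pdivrMr ?exprn_gt0 ?divr_gt0 // mul1r -exprVn invf_div.
  have -> : (c D / w) ^+ k = \prod_(i < k) (c D / w) by rewrite prodr_const card_ord.
  apply: ler_prod => i _; apply/andP; split; first by rewrite ltW // divr_gt0.
  have -> : g' i n = (fracpart (g i n) + D%:R^-1) + (Num.floor (g i n))%:~R.
    by rewrite /g' /fracpart; ring.
  have f0 : 0 <= fracpart (g i n) by rewrite subr_ge0 floor_le_tmp.
  have fd := fg i.
  rewrite bump_addz; apply: le_trans (@bump_lower _ M r t _ _ _ _ _).
  - rewrite lerBrDr -lerBrDl rM -/s; apply: le_trans ueta.
    have p1 := mulr_gt0 Mr s0; have p2 := mulr_gt0 ur s0.
    rewrite ler_pM2l // lef_pV2 ?posrE // ler_pM2r // ler_nat.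
    by rewrite leq_pmull // muln_gt0 d0 ltnW.
  - by rewrite muln_gt0 d0.
  - by rewrite /M /r mulnAC leq_pmulr // ltnW.
  - by rewrite rM lerDr.
  - by rewrite natrD mulrDl rM tM addrC ltrD2l.
have lim : (fun N => (w / c D) ^+ k * avg (fun n => \prod_i bump M J (g' i n)) N)
    @ \oo --> (w / c D) ^+ k * (J%:R / M%:R) ^+ k.
  by apply: cvgMr; apply: avg_bump_prod => //; exact: weyl_indep_shift.
have lt_lim : (w / c D) ^+ k * (J%:R / M%:R) ^+ k < d%:R^-1 ^+ k + e.
  apply: le_lt_trans we; rewrite -exprMn.
  have wc : 0 <= w / c D by rewrite ltW // divr_gt0.
  have jm : 0 <= J%:R / M%:R :> R by rewrite divr_ge0.
  apply: lerXn2r; rewrite ?nnegrE ?(mulr_ge0 wc jm) //; first exact: ltW.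
  by rewrite mulrAC ler_pdivrMr // ler_pM2l.
move/cvgr_lt: lim => /(_ _ lt_lim); apply: filterS => N ltN.
by apply: le_trans (ltW ltN); rewrite -avgZ; exact: le_avg.
Unshelve. all: by end_near. Qed.

(** If r is the residue of floor x modulo d, the fractional part of x / d is (r + fracpart x) / d,
    which is below 1 / d only for r = 0. *)
Lemma fracpart_div_lt (d : nat) (x : R) : (0 < d)%N ->
  (fracpart (x / d%:R) < d%:R^-1) = (d%:Z %| Num.floor x)%Z.
Proof.
move=> d0; have dr : 0 < d%:R :> R by rewrite ltr0n.
set m := Num.floor x; have /andP[mx xm] := floor_itv x.
set q := Num.floor (x / d%:R); have /andP[qx xq] := floor_itv (x / d%:R).
apply/idP/idP => [fr|/dvdzP[l ml]].
  suff -> : m = q * d%:Z by rewrite dvdz_mull.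
  apply: floor_def; rewrite intrD intrM /=; move: qx fr; rewrite /fracpart ler_pdivlMr // => ->.
  by rewrite ltrBlDr ltr_pdivrMr // mulrDl mulVf ?gt_eqF // addrC -/q.
have -> : fracpart (x / d%:R) = (x - m%:~R) / d%:R.
  rewrite /fracpart (_ : Num.floor _ = l); first by rewrite ml intrM; field; rewrite gt_eqF.
  apply: floor_def; rewrite ler_pdivlMr // ltr_pdivrMr //.
  move: mx xm; rewrite -/m ml intrD intrM /= => -> /= /lt_le_trans; apply.
  by rewrite intrD mulrDl mul1r lerD2l ler1n.
by rewrite ltr_pdivrMr // mulVf ?gt_eqF // ltrBlDl -[1]/(1%:~R) -intrD.
Qed.

(* The upper bound suffices: the d^k residue boxes partition the integers. *)
Lemma residue_density f (d : nat) : (0 < d)%N ->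
  weyl_indep (fun i n => f i n / d%:R) ->
  avg (fun n => [forall i, (d%:Z %| Num.floor (f i n))%Z]%:R) @ \oo -->
    (d%:R^-1 : R) ^+ k.
Proof.
move=> d0 fW; have dr : 0 < d%:R :> R by rewrite ltr0n.
case: d => [//|d'] in d0 fW dr *; set d := d'.+1.
pose B (c : {ffun 'I_k -> 'I_d}) n :=
  [forall i, (d%:Z %| Num.floor (f i n) - (c i : nat)%:Z)%Z].
have upper c (e : R) : 0 < e ->
    \forall N \near \oo, avg (fun n => (B c n)%:R) N <= d%:R^-1 ^+ k + e.
  move=> e0.
  have := @box_upper (fun i n => f i n / d%:R + - ((c i : nat)%:R / d%:R)) d e
    (weyl_indep_shift _ fW) d0 e0.
  apply: filterS => N; rewrite [leLHS](_ : _ = avg (fun n => (B c n)%:R) N) //.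
  apply: eq_avg => n; congr (_ : bool)%:R; apply: eq_forallb => i.
  rewrite -mulrBl fracpart_div_lt //; congr (_ %| _)%Z; apply: floor_def.
  have := floor_itv (f i n).
  by rewrite addrAC !intrB lerD2r ltrD2r.
have part n : \sum_c (B c n)%:R = 1 :> R.
  pose c0 := [ffun i => inord `|(Num.floor (f i n) %% d)%Z| : 'I_d].
  have c0E i : (c0 i : nat)%:Z = (Num.floor (f i n) %% d)%Z.
    rewrite ffunE inordK ?gez0_abs ?modz_ge0 //.
    by rewrite -ltz_nat gez0_abs ?modz_ge0 // ltz_pmod.
  rewrite (bigD1 c0) //= big1 ?addr0.
    rewrite (_ : B c0 n = true) //; apply/forallP => i.
    by rewrite c0E -eqz_mod_dvd modz_mod.
  move=> c cc0; rewrite (_ : B c n = false) //; apply: contraNF cc0 => /forallP cB.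
  apply/eqP/ffunP => i; apply/val_inj/eqP; rewrite -eqz_nat c0E.
  have := cB i; rewrite -eqz_mod_dvd => /eqP ->.
  by rewrite modz_small // ltz_nat ltn_ord.
pose z : {ffun 'I_k -> 'I_d} := [ffun=> ord0].
have Bz n : [forall i, (d%:Z %| Num.floor (f i n))%Z] = B z n.
  by apply: eq_forallb => i; rewrite ffunE subr0.
rewrite (_ : avg _ = avg (fun n => (B z n)%:R)); last first.
  by apply/funext => N; apply: eq_avg => n; rewrite Bz.
apply/cvgrPdist_le => e e0.
pose K := #|{ffun 'I_k -> 'I_d}|.
have KE : K%:R * d%:R^-1 ^+ k = 1 :> R.
  by rewrite /K card_ffun !card_ord natrX -exprMn mulfV ?expr1n // gt_eqF.
have K0 : 0 < K%:R :> R.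
  by rewrite ltr0n; apply/card_gt0P; exists z.
(* The averages over the K = d^k boxes sum to 1, so K - 1 upper bounds with error e / K give the
   missing lower bound for [z]. *)
have e1 : 0 < e / K%:R by rewrite divr_gt0.
have allup : \forall N \near \oo, forall c, avg (fun n => (B c n)%:R) N <= d%:R^-1 ^+ k + e / K%:R.
  by apply: filter_forall => c; exact: upper.
near=> N.
have N0 : (0 < N)%N by near: N; exact: nbhs_infty_gt.
have allN : forall c, avg (fun n => (B c n)%:R) N <= d%:R^-1 ^+ k + e / K%:R by near: N.
have tot : \sum_c avg (fun n => (B c n)%:R) N = 1 :> R.
  by rewrite -avg_sum (eq_avg _ part) avg_cst.
rewrite ler_distl; apply/andP; split.
  rewrite lerBlDr; apply: le_trans (allN z) _.
  rewrite lerD2l ler_pdivrMr //; apply: ler_peMr; first exact: ltW.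
  by rewrite ler1n -(ltr0n R).
have : \sum_(c | c != z) avg (fun n => (B c n)%:R) N <=
    \sum_(c | c != z) (d%:R^-1 ^+ k + e / K%:R) by apply: ler_sum.
have : \sum_(c : {ffun 'I_k -> 'I_d}) (d%:R^-1 ^+ k + e / K%:R) = 1 + e.
  by rewrite sumr_const -/K -[LHS]mulr_natl mulrDr KE mulrCA mulfV ?mulr1 ?gt_eqF.
move: tot; rewrite (bigD1 z) //= [X in X = 1 + e -> _](bigD1 z) //=.
have : 0 < e / K%:R by [].
lra.
Unshelve. all: by end_near. Qed.
End Equidistribution.

(** * Averages along the multiples of d *)

Section MultiplesDensity.
Context {R : realType}.

Lemma sum_multiples (F : nat -> R) (d Q : nat) : (0 < d)%N ->
  \sum_(n < d * Q) (if (d %| n)%N then F n else 0) = \sum_(m < Q) F (d * m)%N.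
Proof.
move=> d0; elim: Q => [|Q IHQ]; first by rewrite muln0 !big_ord0.
rewrite big_ord_recr /= -IHQ mulnS addnC big_split_ord /=; congr (_ + _).
rewrite (bigD1 (Ordinal d0)) //= addn0 dvdn_mulr // big1 ?addr0 // => i i0.
rewrite dvdn_addr ?dvdn_mulr // gtnNdvd //.
by rewrite lt0n; apply: contraNN i0 => /eqP i0; apply/eqP/val_inj.
Qed.

Lemma sum_multiples_le (F : nat -> R) (d X : nat) : (0 < d)%N ->
  \sum_(n < X.+1) (if (d %| n)%N then F n else 0) = \sum_(m < (X %/ d).+1) F (d * m)%N.
Proof.
move=> d0; rewrite -sum_multiples //.
have le : (X.+1 <= d * (X %/ d).+1)%N by rewrite mulnC ltn_ceil.
rewrite -(subnKC le) big_split_ord /= [X in _ = _ + X]big1 ?addr0 // => i _.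
case: ifP => // /dvdnP[m mE].
have : (X %/ d < m)%N by rewrite ltn_divLR // -mE ltnS leq_addr.
have : (m < (X %/ d).+1)%N.
  by rewrite -(ltn_pmul2r d0) -mE [((X %/ d).+1 * d)%N]mulnC -ltn_subRL.
by rewrite ltnS leqNgt => /negbTE ->.
Qed.

Lemma cvg_divn (d : nat) : (0 < d)%N -> (fun N => N %/ d)%N @ \oo --> \oo.
Proof.
move=> d0; apply/cvgnyPge => A; exists (A * d)%N => // N /=.
by rewrite leq_divRL.
Qed.

Lemma cvg_divn_ratio (d : nat) : (0 < d)%N ->
  (fun N => (N %/ d)%N%:R / N%:R) @ \oo --> (d%:R^-1 : R).
Proof.
move=> d0; have dr : 0 < d%:R :> R by rewrite ltr0n.
apply: (@squeeze_cvgr _ _ _ _ (fun N => d%:R^-1 - 1 / N%:R) (fun=> d%:R^-1)).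
- exists 1%N => // N /= N0; have Nr : 0 < N%:R :> R by rewrite ltr0n.
  apply/andP; split.
    rewrite lerBlDr -mulrDl ler_pdivlMr // ler_pdivrMl //.
    by rewrite natr1 -natrM ler_nat mulnC ltnW // ltn_ceil.
  rewrite ler_pdivrMr // ler_pdivlMl // -natrM ler_nat mulnC; exact: leq_trunc_div.
- rewrite -[X in _ --> X]subr0; apply: cvgB; [exact: cvg_cst | exact: cvg_invn].
- exact: cvg_cst.
Qed.

(** Up to fewer than d remaining terms, the sum runs over the first N %/ d multiples, and (N %/ d) /
    N tends to 1 / d. *)
Lemma avg_multiples (d : nat) (u : nat -> R) (l : R) : (0 < d)%N ->
  (forall n, 0 <= u n <= 1) -> avg (fun m => u (d * m)%N) @ \oo --> l ->
  avg (fun n => if (d %| n)%N then u n else 0) @ \oo --> l / d%:R.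
Proof.
move=> d0 u01 ul; set v := fun n => if _ then _ else _.
have v01 n : 0 <= v n <= 1 by rewrite /v; case: ifP => // _; rewrite lexx ler01.
pose B N := avg (fun m => u (d * m)%N) (N %/ d) * ((N %/ d)%N%:R / N%:R).
have main : B @ \oo --> l / d%:R.
  apply: cvgM; last exact: cvg_divn_ratio.
  exact: (@cvg_comp _ _ _ (fun N => N %/ d)%N (avg (fun m => u (d * m)%N)) _ _ _ (cvg_divn d0) ul).
have err : (fun N => avg v N - B N) @ \oo --> (0 : R).
  apply: (@squeeze_cvgr _ _ _ _ (fun=> 0) (fun N => d%:R / N%:R)).
  - exists d => // N /= dN.
    have Q0 : (0 < N %/ d)%N by rewrite divn_gt0.
    have -> : B N = (\sum_(m < N %/ d) u (d * m)%N) / N%:R.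
      by rewrite /B /avg mulrA divfK // pnatr_eq0 -lt0n.
    rewrite -sum_multiples // /avg -mulrBl.
    have NE : N = (d * (N %/ d) + N %% d)%N by rewrite mulnC -divn_eq.
    have -> : \sum_(n < N) v n - \sum_(n < d * (N %/ d)) v n =
        \sum_(i < N %% d) v (d * (N %/ d) + i)%N.
      rewrite -(big_mkord xpredT v) [in X in \sum_(0 <= _ < X) _]NE big_mkord.
      by rewrite big_split_ord /= addrAC subrr add0r.
    have sge : 0 <= \sum_(i < N %% d) v (d * (N %/ d) + i)%N.
      by rewrite sumr_ge0 // => i _; case/andP: (v01 (d * (N %/ d) + i)%N).
    rewrite divr_ge0 //= ler_wpM2r ?invr_ge0 //.
    apply: le_trans (_ : \sum_(i < N %% d) 1 <= _).
      by apply: ler_sum => i _; case/andP: (v01 (d * (N %/ d) + i)%N).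
    by rewrite sumr_const card_ord ler_nat ltnW // ltn_mod.
  - exact: cvg_cst.
  - exact: cvg_invn.
rewrite (_ : avg v = fun N => (avg v N - B N) + B N).
  by rewrite -[X in _ --> X]add0r; exact: cvgD.
by apply/funext => N; rewrite subrK.
Qed.

End MultiplesDensity.

(** * Densities for finitely many primes *)

Section GcdFloors.
Context {R : realType} {k : nat}.
Context (f : 'I_k -> {poly R}).

Lemma dvdn_gcd_floors (d n : nat) :
  (d %| gcd_floors f n)%N =
  (d %| n)%N && [forall i, (d%:Z %| Num.floor (f i).[n%:R])%Z].
Proof.
rewrite /gcd_floors dvdn_gcd; congr (_ && _).
apply/dvdn_biggcdP/forallP => [H i|H i _]; first by rewrite dvdzE H.
by have := H i; rewrite dvdzE.
Qed.

Context (hirr : forall h : 'I_k -> int, (exists i : 'I_k, h i <> 0) ->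
  exists j : nat, (0 < j)%N /\ irrational (lincomb h f)`_j).

(** The substitution n = d m builds in d | n, and the division by d turns divisibility of the floors
    into a box condition. Together they multiply the coefficient of index j by d^j / d, a non-zero
    rational, so irrationality is preserved. *)
Lemma poly_weyl_indep (d : nat) : (0 < d)%N ->
  weyl_indep (fun i m => (f i).[(d * m)%N%:R] / d%:R).
Proof.
move=> d0 h [i hi] th; have dr : d%:R != 0 :> R by rewrite pnatr_eq0 -lt0n.
pose L := lincomb h f.
pose P := \poly_(j < size L) (d%:R ^+ j / d%:R * L`_j) + th%:P.
have PE m : \sum_i (h i)%:~R * ((f i).[(d * m)%N%:R] / d%:R) + th = P.[m%:R].
  rewrite hornerD hornerC horner_poly; congr (_ + _).
  have -> : \sum_i (h i)%:~R * ((f i).[(d * m)%N%:R] / d%:R) = L.[(d * m)%N%:R] / d%:R.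
    rewrite /L /lincomb horner_sum mulr_suml; apply: eq_bigr => j _.
    by rewrite hornerZ mulrA.
  rewrite horner_coef mulr_suml; apply: eq_bigr => j _.
  by rewrite natrM exprMn; ring.
rewrite (_ : avg _ = avg (fun m => cosp P.[m%:R])); last first.
  by apply/funext => N; apply: eq_avg => m; rewrite PE.
apply: weyl_sum_irrational.
have [j [j0 jL]] : exists j : nat, (0 < j)%N /\ irrational L`_j.
  by apply: hirr; exists i; apply/eqP.
exists j; split=> //; rewrite coefD coefC gtn_eqF // addr0 coef_poly.
case: ltnP => [_|sj]; last first.
  by move: jL; rewrite nth_default // => /(_ (rational_nat 0)).
rewrite -[_ * _]addr0; apply: irrationalMD => //; last exact: (rational_nat 0).
  by apply: rationalM; [rewrite -natrX; exact: rational_nat | apply: rationalV; exact: rational_nat].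
by rewrite mulf_neq0 ?expf_neq0 ?invr_neq0.
Qed.

Lemma density_dvd_gcd_floors (d : nat) : (0 < d)%N ->
  avg (fun n => (d %| gcd_floors f n)%N%:R) @ \oo --> (d%:R^-1 : R) ^+ k.+1.
Proof.
move=> d0.
have := residue_density d0 (poly_weyl_indep d0).
move=> /(avg_multiples (u := fun n => [forall i, (d%:Z %| Num.floor (f i).[n%:R])%Z]%:R) d0).
rewrite exprSr; set u := fun n => if _ then _ else _ => H.
rewrite (_ : avg _ = avg u); first by apply: H => n; rewrite ler0n lern1 leq_b1.
by apply/funext => N; apply: eq_avg => n; rewrite dvdn_gcd_floors /u; case: ifP.
Qed.

(** The divisor e makes the induction on the primes close: sieving by one more p subtracts the same
    quantity with e replaced by e p. *)
Definition sieved (e : nat) (ps : seq nat) (n : nat) : bool :=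
  (e %| gcd_floors f n)%N && all (fun p => ~~ (p %| gcd_floors f n)%N) ps.

Lemma density_sieved (ps : seq nat) (e : nat) : (0 < e)%N -> uniq ps ->
  (forall p, p \in ps -> prime p /\ coprime e p) ->
  avg (fun n => (sieved e ps n)%:R) @ \oo -->
    (e%:R^-1 : R) ^+ k.+1 * \prod_(p <- ps) (1 - (p%:R^-1) ^+ k.+1).
Proof.
elim: ps e => [|p ps IHps] e e0.
  move=> _ _; rewrite big_nil mulr1.
  rewrite (_ : avg _ = avg (fun n => (e %| gcd_floors f n)%N%:R)).
    exact: density_dvd_gcd_floors.
  by apply/funext => N; apply: eq_avg => n; rewrite /sieved andbT.
move=> /= /andP[pps ups] hps; have [pp pe] := hps p (mem_head _ _).
have p0 := prime_gt0 pp.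
have h1 : avg (fun n => (sieved e ps n)%:R) @ \oo -->
    (e%:R^-1 : R) ^+ k.+1 * \prod_(p <- ps) (1 - (p%:R^-1) ^+ k.+1).
  by apply: IHps => // r rps; apply: hps; rewrite inE rps orbT.
have h2 : avg (fun n => (sieved (e * p) ps n)%:R) @ \oo -->
    ((e * p)%N%:R^-1 : R) ^+ k.+1 * \prod_(p <- ps) (1 - (p%:R^-1) ^+ k.+1).
  apply: IHps => //; first by rewrite muln_gt0 e0.
  move=> r rps; have [pr er] : prime r /\ coprime e r by apply: hps; rewrite inE rps orbT.
  split=> //; rewrite coprimeMl er prime_coprime // dvdn_prime2 //.
  by apply: contraNN pps => /eqP ->.
rewrite big_cons.
have -> : (e%:R^-1 : R) ^+ k.+1 * ((1 - p%:R^-1 ^+ k.+1) * \prod_(j <- ps) (1 - j%:R^-1 ^+ k.+1)) =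
   (e%:R^-1 : R) ^+ k.+1 * \prod_(p <- ps) (1 - (p%:R^-1) ^+ k.+1) -
   ((e * p)%N%:R^-1 : R) ^+ k.+1 * \prod_(p <- ps) (1 - (p%:R^-1) ^+ k.+1).
  by rewrite natrM invfM exprMn; ring.
rewrite (_ : avg _ = fun N => avg (fun n => (sieved e ps n)%:R) N -
    avg (fun n => (sieved (e * p) ps n)%:R) N); first exact: cvgB.
apply/funext => N /=; rewrite -avgN -avgD; apply: eq_avg => n.
rewrite /sieved Gauss_dvd //=.
case: (e %| _)%N; case: (p %| _)%N; case: (all _ ps) => /=;
  by rewrite ?mulr1n ?mulr0n ?subr0 ?subrr.
Qed.
End GcdFloors.

(** * Distance to the nearest integer *)

Section DistanceToIntegers.
Context {R : realType}.
Implicit Types (x y : R) (l : int).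

Definition dist x : R := Num.min (fracpart x) (1 - fracpart x).

Lemma fracpart_itv x : 0 <= fracpart x < 1.
Proof.
have := floor_itv x; rewrite intrD /fracpart => /andP[? ?].
by rewrite subr_ge0 ltrBlDr addrC; apply/andP.
Qed.

Lemma dist_attained x : exists l, dist x = `|x - l%:~R|.
Proof.
have /andP[f0 f1] := fracpart_itv x; rewrite /dist /fracpart in f0 f1 *.
rewrite /Num.min; case: ifP => _; first by exists (Num.floor x); rewrite ger0_norm.
exists (Num.floor x + 1); rewrite intrD ler0_norm; [ring | lra].
Qed.

Lemma dist_le x l : dist x <= `|x - l%:~R|.
Proof.
have /andP[f0 f1] := fracpart_itv x; rewrite /dist ge_min.
have [m xE] : exists m : int, x = m%:~R + fracpart x.
  by exists (Num.floor x); rewrite /fracpart addrC subrK.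
move: (fracpart x) xE f0 f1 => r -> r0 r1.
have [lm|lm] := leP l m.
  have : l%:~R <= m%:~R :> R by rewrite ler_int.
  by move=> lmr; apply/orP; left; rewrite ger0_norm; lra.
have : m%:~R + 1 <= l%:~R :> R by rewrite -[1]/(1%:~R) -intrD ler_int lezD1.
by move=> lmr; apply/orP; right; rewrite ler0_norm; lra.
Qed.

Lemma dist_ge0 x : 0 <= dist x.
Proof. by have [l ->] := dist_attained x. Qed.

Lemma distB x y : dist (x - y) <= dist x + dist y.
Proof.
have [l ->] := dist_attained x; have [m ->] := dist_attained y.
apply: le_trans (dist_le _ (l - m)) _; rewrite intrB.
rewrite (_ : x - y - _ = (x - l%:~R) - (y - m%:~R)); last by ring.
exact: ler_normB.
Qed.

Lemma dist_mulrn x (n : nat) : dist (n%:R * x) <= n%:R * dist x.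
Proof.
have [l ->] := dist_attained x.
apply: le_trans (dist_le _ (n%:Z * l)) _.
by rewrite intrM -mulrBr normrM normr_nat.
Qed.

Lemma dist_gt0 (a : R) (n : nat) : irrational a -> (0 < n)%N -> 0 < dist (n%:R * a).
Proof.
move=> airr n0; rewrite lt_neqAle dist_ge0 andbT eq_sym; apply/eqP => d0.
have [l lE] := dist_attained (n%:R * a).
have : n%:R * a - l%:~R = 0 by apply/eqP; rewrite -normr_eq0 -lE d0.
move/eqP; rewrite subr_eq0 => /eqP aE; apply: airr; apply/rationalP.
by exists l, n; rewrite -aE mulrC mulKf // pnatr_eq0 -lt0n.
Qed.

End DistanceToIntegers.

(** * Best rational approximations *)

Section BestApproximations.
Context {R : realType} (a : R) (airr : irrational a).

Let da (j : nat) : R := dist (j%:R * a).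

(** Pigeonhole: the Q + 1 fractional parts of i a with 0 <= i <= Q fall into Q intervals of length 1
    / Q. *)
Lemma dirichlet (Q : nat) : (0 < Q)%N ->
  exists j : nat, [/\ (0 < j)%N, (j <= Q)%N & da j < Q%:R^-1].
Proof.
move=> Q0; have Qr : 0 < Q%:R :> R by rewrite ltr0n.
case: Q Q0 Qr => // Q' _; set Q := Q'.+1 => Qr.
pose F (i : 'I_Q.+1) : 'I_Q := inord (Num.truncn (Q%:R * fracpart (i%:R * a))).
have Fv i : (F i)%:R <= Q%:R * fracpart (i%:R * a) < (F i)%:R + 1.
  have /andP[f0 f1] := fracpart_itv (i%:R * a).
  have p0 : 0 <= Q%:R * fracpart (i%:R * a) by rewrite mulr_ge0 // ltW.
  have tF := truncn_itv p0.
  rewrite /F inordK ?natr1 // -(ltr_nat R).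
  by case/andP: tF => t0 _; apply: le_lt_trans t0 _; rewrite -[ltRHS]mulr1 ltr_pM2l.
have [i [j [ij Fij]]] : exists i j : 'I_Q.+1, (i < j)%N /\ F i = F j.
  have : ~~ injectiveb F.
    apply/negP => /injectiveP /leq_card; rewrite !card_ord ltnn //.
  move=> /injectivePn[i [j ij Fij]].
  case: (ltngtP i j) => [lt|gt|e]; [by exists i, j | by exists j, i |].
  by move/eqP: ij; case; apply: val_inj.
exists (j - i)%N; split; first by rewrite subn_gt0.
  by rewrite (leq_trans (leq_subr _ _)) // -ltnS ltn_ord.
have := Fv i; have := Fv j; rewrite Fij => /andP[j0 j1] /andP[i0 i1].
rewrite /da (natrB _ (ltnW ij)) mulrBl.
apply: le_lt_trans (dist_le _ (Num.floor (j%:R * a) - Num.floor (i%:R * a))) _.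
have -> : j%:R * a - i%:R * a - (Num.floor (j%:R * a) - Num.floor (i%:R * a))%:~R =
    fracpart (j%:R * a) - fracpart (i%:R * a) by rewrite intrB /fracpart; ring.
rewrite -(ltr_pM2l Qr) mulfV ?gt_eqF // -{1}(ger0_norm (ltW Qr)) -normrM.
by rewrite ltr_norml; apply/andP; split; rewrite mulrBr; lra.
Qed.

(* The records are the denominators of the best rational approximations,
   i.e. of the continued fraction convergents of [a]. *)
Definition record (q : nat) : bool :=
  (0 < q)%N && [forall j : 'I_q, (0 < j)%N ==> (da q < da j)].

Lemma recordP (q : nat) : reflect
  ((0 < q)%N /\ forall j, (0 < j)%N -> (j < q)%N -> da q < da j) (record q).
Proof.
apply: (iffP andP) => -[q0 H]; split=> //.
  by move=> j j0 jq; have /forallP/(_ (Ordinal jq))/implyP/(_ j0) := H.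
by apply/forallP => j; apply/implyP => j0; apply: H.
Qed.

Lemma next_record (q : nat) : record q -> exists p : nat,
  [/\ record p, (q < p)%N, forall j, (0 < j)%N -> (j < p)%N -> da q <= da j,
      da p < da q & da q <= 2 / p%:R].
Proof.
move=> /recordP[q0 qr].
pose P p := (0 < p)%N && (da p < da q).
have exP : exists p, P p.
  have dq := dist_gt0 airr q0; have Q0 : (0 < (Num.truncn (da q)^-1).+1)%N by [].
  have [j [j0 jQ jd]] := dirichlet Q0; exists j; rewrite /P j0 /=.
  apply: lt_trans jd _; rewrite invf_plt ?posrE ?ltr0n //; exact: truncnS_gt.
have [p /andP[p0 pq] pmin] := ex_minnP exP.
have pmin' j : (0 < j)%N -> (j < p)%N -> da q <= da j.
  move=> j0 jp; rewrite leNgt; apply/negP => jd.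
  by have := pmin j; rewrite /P j0 jd leqNgt jp => /(_ isT).
have qp : (q < p)%N.
  rewrite ltnNge; apply/negP; rewrite leq_eqVlt => /orP[/eqP pE|lt].
    by rewrite pE ltxx in pq.
  by have := qr p p0 lt; rewrite ltNge ltW.
exists p; split=> //.
  apply/recordP; split=> // j j0 jp; exact: lt_le_trans pq (pmin' _ j0 jp).
(* Dirichlet's theorem for p - 1 yields an index below p, hence no better than q: da q < 1 / (p - 1)
   <= 2 / p. *)
have p1 : (0 < p.-1)%N by rewrite -ltnS prednK // (leq_ltn_trans q0).
have [j [j0 jp jd]] := dirichlet p1.
have jp' : (j < p)%N by rewrite -(prednK p0) ltnS.
apply: le_trans (pmin' _ j0 jp') _; apply: le_trans (ltW jd) _.
rewrite ler_pdivlMr ?ltr0n // mulrC ler_pdivrMr ?ltr0n // -natrM ler_nat.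
by rewrite mul2n -addnn -{1}(prednK p0) -addn1 leq_add2l.
Qed.

(* The integers a', a'' nearest to q a and p a satisfy
   |a'' q - a' p| >= 1, whence 1 <= q |p a - a''| + p |q a - a'| <= 2 p |q a - a'|. *)
Lemma next_record_spacing (q p : nat) : record q -> (q < p)%N -> da p < da q ->
  1 / (2 * p%:R) <= da q.
Proof.
move=> /recordP[q0 _] qp pq; have p0 := leq_ltn_trans q0 qp.
have qr : 0 < q%:R :> R by rewrite ltr0n.
have pr : 0 < p%:R :> R by rewrite ltr0n (leq_trans _ qp).
have [l lE] := dist_attained (q%:R * a); have [m mE] := dist_attained (p%:R * a).
rewrite -/(da q) -/(da p) in lE mE.
have qpr : q%:R < p%:R :> R by rewrite ltr_nat.
have dq := dist_ge0 (q%:R * a); rewrite -/(da q) in dq.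
have d : (q%:Z * m - p%:Z * l)%:~R = p%:R * (q%:R * a - l%:~R) - q%:R * (p%:R * a - m%:~R).
  by rewrite intrB !intrM; ring.
(* A zero determinant would give p da q = q da p, contrary to q < p and da p < da q. *)
have [z|nz] := eqVneq (q%:Z * m - p%:Z * l) 0.
  move: d; rewrite z => /esym/eqP; rewrite subr_eq0 => /eqP d.
  have : p%:R * da q = q%:R * da p :> R.
    by have := congr1 Num.norm d; rewrite !normrM (gtr0_norm pr) (gtr0_norm qr) -lE -mE.
  have : q%:R * da p < q%:R * da q by rewrite ltr_pM2l.
  have : q%:R * da q <= p%:R * da q by rewrite ler_wpM2r // ltW.
  lra.
have n1 : 1 <= `|(q%:Z * m - p%:Z * l)%:~R| :> R.
  by rewrite -intr_norm -[1]/(1%:~R) ler_int -gtz0_ge1 normr_gt0.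
rewrite ler_pdivrMr ?mulr_gt0 //.
have : `|(q%:Z * m - p%:Z * l)%:~R| <= p%:R * da q + q%:R * da p.
  by rewrite d (le_trans (ler_normB _ _)) // !normrM (gtr0_norm pr) (gtr0_norm qr) -lE -mE.
have : q%:R * da p <= q%:R * da q by rewrite ler_pM2l // ltW.
have : q%:R * da q <= p%:R * da q by rewrite ler_wpM2r // ltW.
lra.
Qed.

Lemma record1 : record 1.
Proof. by apply/recordP; split=> // j; case: j. Qed.

(** The successor of the last record p before q is q itself. So every j < q has da j >= da p, and da
    p is at least 1 / (2 q) by the determinant bound. *)
Lemma record_spacing (q : nat) : record q ->
  forall j, (0 < j)%N -> (j < q)%N -> 1 / (2 * q%:R) <= da j.
Proof.
move=> rq j j0 jq; have [q0 qr] := recordP _ rq.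
have q1 : (1 < q)%N by apply: leq_ltn_trans jq.
pose P p := record p && (p < q)%N.
have exP : exists p, P p by exists 1%N; rewrite /P record1.
have bP p : P p -> (p <= q)%N by case/andP=> _ /ltnW.
have [p /andP[rp pq] pmax] := ex_maxnP exP bP.
have [p' [rp' pp' p'min p'p _]] := next_record rp.
have qp : da q < da p by apply: qr => //; case/recordP: rp.
have p'q : p' = q.
  apply/eqP; rewrite eqn_leq; apply/andP; split.
    rewrite leqNgt; apply/negP => lt; have := p'min q q0 lt.
    by rewrite leNgt qp.
  rewrite leqNgt; apply/negP => lt; have := pmax p'; rewrite /P rp' lt => /(_ isT).
  by rewrite leqNgt pp'.
apply: le_trans (p'min j j0 _); last by rewrite p'q.
exact: next_record_spacing.
Qed.

Lemma consecutive_records (N : nat) : (0 < N)%N -> exists q p : nat,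
  [/\ record q, record p, (q ^ 2 <= N)%N, (N < p ^ 2)%N & da q <= 2 / p%:R].
Proof.
move=> N0; pose P q := record q && (q ^ 2 <= N)%N.
have exP : exists q, P q by exists 1%N; rewrite /P record1.
have bP q : P q -> (q <= N)%N.
  case/andP=> /recordP[q0 _] /(leq_trans _); apply.
  by rewrite -{1}[q]expn1 leq_pexp2l.
have [q /andP[rq qN] qmax] := ex_maxnP exP bP.
have [p [rp qp _ _ dqp]] := next_record rq.
exists q, p; split=> //; rewrite ltnNge; apply/negP => pN.
by have := qmax p; rewrite /P rp pN leqNgt qp => /(_ isT).
Qed.
End BestApproximations.

(** * Counting multiples of a near integers *)

Section Counting.
Context {R : realType}.

(** Offsets from the nearest integers at two indices of the block differ by at least 1 / (2 q), as
    the index difference is below q. Cutting [-eta, eta] into cells of length 1 / (2 q) leaves at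
    most one index per cell. *)
Lemma sum_spaced (a eta : R) (m0 q : nat) : (0 < q)%N -> 0 <= eta ->
  (forall j, (0 < j)%N -> (j < q)%N -> 1 / (2 * q%:R) <= dist (j%:R * a)) ->
  \sum_(r < q) (dist ((m0 + r)%N%:R * a) <= eta)%R%:R <= 4 * q%:R * eta + 1 :> R.
Proof.
move=> q0 eta0 sp; have qr : 0 < q%:R :> R by rewrite ltr0n.
pose S := [set r : 'I_q | dist ((m0 + r)%N%:R * a) <= eta]%SET.
have -> : \sum_(r < q) (dist ((m0 + r)%N%:R * a) <= eta)%R%:R = #|S|%:R :> R.
  rewrite -sum1_card natr_sum big_mkcond /=; rewrite [RHS]big_mkcond /=.
  by apply: eq_bigr => r _; rewrite inE; case: ifP.
have [near nearE] := choice (fun r : 'I_q => dist_attained ((m0 + r)%N%:R * a)).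
pose y (r : 'I_q) : R := (m0 + r)%N%:R * a - (near r)%:~R.
have yE (r : 'I_q) : dist ((m0 + r)%N%:R * a) = `|y r| by exact: nearE.
have sqe : 0 <= 4 * q%:R * eta by rewrite !mulr_ge0.
pose K := (Num.truncn (4 * q%:R * eta)).+1.
pose F (r : 'I_q) : 'I_K := inord (Num.truncn ((y r + eta) * (2 * q%:R))).
have Finj : {in S &, injective F}.
  move=> r r'; rewrite !inE !yE => rS rS' Frr'; apply/eqP/contraT => rr'.
  have bnd z : `|z| <= eta -> 0 <= (z + eta) * (2 * q%:R) <= 4 * q%:R * eta.
    rewrite ler_norml => /andP[z0 z1]; rewrite mulr_ge0 ?mulr_ge0 //; last lra.
    by rewrite (_ : 4 * q%:R * eta = (eta + eta) * (2 * q%:R)) ?ler_wpM2r ?mulr_ge0 ?lerD2r //; ring.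
  have Fv z : `|z| <= eta -> (Num.truncn ((z + eta) * (2 * q%:R)) < K)%N.
    by move=> /bnd /andP[_ zb]; rewrite ltnS le_truncn.
  have := congr1 (@nat_of_ord K) Frr'; rewrite /F !inordK ?Fv // => tE.
  have /andP[b1 _] := bnd _ rS; have /andP[b2 _] := bnd _ rS'.
  have := truncn_itv b1; have := truncn_itv b2; rewrite tE -natr1 => /andP[u1 u2] /andP[u3 u4].
  have close : `|y r - y r'| < 1 / (2 * q%:R).
    rewrite ltr_pdivlMr ?mulr_gt0 // -{1}(gtr0_norm (_ : 0 < 2 * q%:R)) ?mulr_gt0 //.
    by rewrite -normrM ltr_norml mulrBl; apply/andP; split; lra.
  have key (s s' : 'I_q) : (s < s')%N -> `|y s' - y s| < 1 / (2 * q%:R) -> false.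
    move=> ss' cl; have j0 : (0 < s' - s)%N by rewrite subn_gt0.
    have jq : (s' - s < q)%N by rewrite (leq_ltn_trans (leq_subr _ _)).
    have := sp _ j0 jq; rewrite leNgt => /negP; case; apply: le_lt_trans cl.
    apply: le_trans (dist_le _ (near s' - near s)) _; rewrite intrB (natrB _ (ltnW ss')).
    have -> : (s'%:R - s%:R) * a - ((near s')%:~R - (near s)%:~R) = y s' - y s.
      by rewrite /y !natrD; ring.
    exact: lexx.
  case: (ltngtP r r') => [lt|gt|/val_inj e]; last by rewrite e eqxx in rr'.
    by apply: (key _ _ lt); rewrite distrC.
  exact: (key _ _ gt).
have : (#|S| <= K)%N.
  by rewrite -(card_in_imset Finj) -[X in (_ <= X)%N](card_ord K) max_card.
rewrite -(ler_nat R) => /le_trans; apply.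
by rewrite /K -natr1 lerD2r truncn_le.
Qed.

Lemma sum_dist_le (a eta : R) (q L : nat) : (0 < q)%N -> 0 <= eta ->
  (forall j, (0 < j)%N -> (j < q)%N -> 1 / (2 * q%:R) <= dist (j%:R * a)) ->
  \sum_(m < L) (dist (m%:R * a) <= eta)%R%:R <=
    (L%:R / q%:R + 1) * (4 * q%:R * eta + 1) :> R.
Proof.
move=> q0 eta0 sp; have qr : 0 < q%:R :> R by rewrite ltr0n.
have blocks B : \sum_(m < B * q) (dist (m%:R * a) <= eta)%R%:R <=
    B%:R * (4 * q%:R * eta + 1) :> R.
  elim: B => [|B IHB]; first by rewrite mul0n big_ord0 mul0r.
  rewrite mulSn addnC big_split_ord /= -natr1 mulrDl mul1r lerD //.
  exact: sum_spaced.
apply: le_trans (_ : (L %/ q).+1%:R * (4 * q%:R * eta + 1) <= _).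
  apply: le_trans (blocks _).
  have LB : (L <= (L %/ q).+1 * q)%N by rewrite ltnW // ltn_ceil.
  rewrite -(subnKC LB) big_split_ord /= lerDl sumr_ge0 //.
rewrite ler_wpM2r ?addr_ge0 ?mulr_ge0 // -natr1 lerD2r ler_pdivlMr // -natrM ler_nat.
exact: leq_trunc_div.
Qed.

Lemma sum_inv_sqr_tail (D N : nat) : (0 < D)%N ->
  \sum_(d < N | (D < d)%N) (d%:R ^+ 2)^-1 <= D%:R^-1 :> R.
Proof.
move=> D0.
(* The subtracted term makes the bound telescope in the induction; [maxn] keeps it valid while the
   sum is empty. *)
suff H : \sum_(d < N | (D < d)%N) (d%:R ^+ 2)^-1 <= D%:R^-1 - (maxn D N.-1)%:R^-1 :> R.
  by apply: le_trans H _; rewrite gerDl oppr_le0 invr_ge0.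
elim: N => [|N IHN]; first by rewrite big_ord0 maxn0 subrr.
rewrite big_mkcond big_ord_recr -big_mkcond /=.
case: ifPn => [DN|]; last first.
  rewrite -leqNgt => ND; rewrite addr0 (maxn_idPl ND); apply: le_trans IHN _.
  by rewrite (maxn_idPl (leq_trans (leq_pred _) ND)).
have N0 := leq_trans D0 (ltnW DN).
apply: le_trans (lerD IHN (lexx _)) _.
have -> : maxn D N.-1 = N.-1 by apply/maxn_idPr; rewrite -ltnS prednK.
have -> : maxn D N = N by apply/maxn_idPr; exact: ltnW.
rewrite -addrA lerD2l.
have N1 : (0 < N.-1)%N by rewrite -ltnS prednK //; exact: leq_ltn_trans DN.
have NE : N%:R = N.-1%:R + 1 :> R by rewrite natr1 prednK.
have n1 : 0 < N.-1%:R :> R by rewrite ltr0n.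
rewrite NE -subr_ge0.
have -> : - (N.-1%:R + 1)^-1 - (- N.-1%:R^-1 + ((N.-1%:R + 1) ^+ 2)^-1) =
   (N.-1%:R * (N.-1%:R + 1) ^+ 2)^-1 :> R.
  by field; rewrite !gt_eqF // addr_gt0.
by rewrite invr_ge0 mulr_ge0 // ltW // exprn_gt0 // addr_gt0.
Qed.
End Counting.

(** * Rarity of large common divisors *)

Section Tail.
Context {R : realType}.

(* 0 is included, as every integer divides it; this does not affect densities. *)
Definition large_common_divisor (a b : R) (D n : nat) : bool :=
  (n == 0)%N || [exists d : 'I_n.+1,
    [&& (D < d)%N, (d %| n)%N & (d%:Z %| Num.floor (a * n%:R + b))%Z]].

Lemma dist_of_divisor (a b : R) (d m : nat) : (0 < d)%N ->
  (d%:Z %| Num.floor (a * (d * m)%N%:R + b))%Z ->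
  dist (m%:R * a) <= (1 + `|b|) / d%:R.
Proof.
move=> d0 /dvdzP[l lE]; have dr : 0 < d%:R :> R by rewrite ltr0n.
have /andP[fl fr] := floor_itv (a * (d * m)%N%:R + b).
apply: le_trans (dist_le _ l) _.
rewrite ler_pdivlMr // -{1}(gtr0_norm dr) -normrM ler_norml.
move: fl fr; rewrite lE intrD !intrM natrM /=.
have := ler_norm b; have := ler_norm (- b); rewrite normrN => b1 b2 fl fr.
have -> : (m%:R * a - l%:~R) * d%:R = a * (d%:R * m%:R) - l%:~R * d%:R by ring.
by apply/andP; split; lra.
Qed.

Section Bound.
Context (a b : R) (airr : irrational a) (N q p : nat) (N0 : (0 < N)%N).
Context (rq : record a q) (rp : record a p) (qN : (q ^ 2 <= N)%N) (Np : (N < p ^ 2)%N).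
Context (dq : dist (q%:R * a) <= 2 / p%:R).

Let c : R := 1 + `|b|.
(** Covers both cases of [count_dist_small]: blocks of length q give 64 c^2 + 8 c, blocks of length
    p give 68 c + 136. *)
Let C : R := 64 * c ^+ 2 + 68 * c + 136.

Let q0 : 0 < q%:R :> R.
Proof. by rewrite ltr0n; case/recordP: rq. Qed.

Let p0 : 0 < p%:R :> R.
Proof. by rewrite ltr0n; case/recordP: rp. Qed.

Let c1 : 1 <= c.
Proof. by rewrite lerDl. Qed.

Let c0 : 0 <= c.
Proof. exact: le_trans ler01 c1. Qed.

Let Nr : 0 < N%:R :> R.
Proof. by rewrite ltr0n. Qed.

(** Outside these ranges c / d < 1 / (4 q), and 2 t / p < 1 / (4 q) whenever t q d <= N: each is
    half of the spacing 1 / (2 q). *)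
Let small (d : nat) : bool := (d%:R <= 4 * c * q%:R) || (d * p <= 8 * N)%N.

Let count_dist (d : nat) : R :=
  \sum_(m < (N %/ d).+1) (dist (m%:R * a) <= c / d%:R)%R%:R.

Let count_dist_le (d r : nat) : (0 < d)%N -> record a r ->
  count_dist d <= (N%:R / (d%:R * r%:R) + 2) * (4 * r%:R * (c / d%:R) + 1).
Proof.
move=> d0 rr; have [r0 _] := recordP _ _ rr.
have dr : 0 < d%:R :> R by rewrite ltr0n.
have rr0 : 0 < r%:R :> R by rewrite ltr0n.
have cd : 0 <= c / d%:R by rewrite divr_ge0.
apply: le_trans (sum_dist_le _ r0 cd (record_spacing airr rr)) _.
have cd1 : 0 <= 4 * r%:R * (c / d%:R) + 1 by rewrite addr_ge0 // mulr_ge0 // mulr_ge0.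
rewrite ler_wpM2r //.
have -> : N%:R / (d%:R * r%:R) + 2 = N%:R / d%:R / r%:R + 1 + 1 :> R.
  by field; rewrite !gt_eqF.
rewrite lerD2r -natr1 mulrDl lerD //.
  rewrite ler_wpM2r ?invr_ge0 // ler_pdivlMr // -natrM ler_nat.
  exact: leq_trunc_div.
by rewrite mul1r invf_le1 // ler1n.
Qed.

(** Every term of the expanded block bound is O(N / d^2). For length q this uses d = O(q) and q^2 <=
    N; for length p it uses d p <= 8 N and N < p^2, which give d <= 8 p. *)
Let count_dist_small (d : nat) : (0 < d)%N -> small d ->
  count_dist d <= C * N%:R / d%:R ^+ 2.
Proof.
move=> d0 sd; have dr : 0 < d%:R :> R by rewrite ltr0n.
have qN' : q%:R ^+ 2 <= N%:R :> R by rewrite -natrX ler_nat.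
have Np' : N%:R <= p%:R ^+ 2 :> R by rewrite -natrX ler_nat ltnW.
rewrite ler_pdivlMr ?exprn_gt0 //.
case/orP: sd => [sd|].
  apply: le_trans (ler_wpM2r _ (count_dist_le d0 rq)) _; first exact: sqr_ge0.
  have -> : (N%:R / (d%:R * q%:R) + 2) * (4 * q%:R * (c / d%:R) + 1) * d%:R ^+ 2 =
     (N%:R + 2 * (d%:R * q%:R)) * (4 * c * q%:R + d%:R) / q%:R :> R.
    by field; rewrite !gt_eqF.
  rewrite ler_pdivrMr //.
  apply: le_trans (_ : (N%:R + 2 * (4 * c * q%:R * q%:R)) * (8 * c * q%:R) <= _).
    rewrite ler_pM //; rewrite ?addr_ge0 ?mulr_ge0 //; try lra.
    by rewrite lerD2l ler_pM2l // ler_wpM2r // ltW.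
  rewrite mulrA ler_pM2r //.
  have : c * (8 * c * q%:R ^+ 2) <= c * (8 * c * N%:R).
    by rewrite ler_wpM2l // ler_wpM2l // mulr_ge0.
  rewrite /C; have : 0 <= c * N%:R by rewrite mulr_ge0.
  by have := Nr; lra.
rewrite -(ler_nat R) !natrM => sd.
apply: le_trans (ler_wpM2r _ (count_dist_le d0 rp)) _; first exact: sqr_ge0.
have -> : (N%:R / (d%:R * p%:R) + 2) * (4 * p%:R * (c / d%:R) + 1) * d%:R ^+ 2 =
     (N%:R + 2 * (d%:R * p%:R)) * (4 * c + d%:R / p%:R) :> R.
  by field; rewrite !gt_eqF.
have dp : d%:R / p%:R <= 8 :> R.
  rewrite ler_pdivrMr // -(ler_pM2r p0) (le_trans sd) // -mulrA -expr2 ler_pM2l //.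
have dp0 : 0 <= d%:R / p%:R :> R by rewrite divr_ge0.
apply: le_trans (_ : (17 * N%:R) * (4 * c + 8) <= _).
  apply: ler_pM; rewrite ?addr_ge0 ?mulr_ge0 //; lra.
rewrite /C; have : 0 <= c ^+ 2 * N%:R by rewrite mulr_ge0 ?sqr_ge0.
lra.
Qed.

(* Write m = t q + r: then r a is within 1/(4q) + t |q a - a'| of an integer,
   and both terms are too small for r < q unless r = 0. *)
Let dvdn_of_dist_large (d m : nat) : (0 < d)%N -> ~~ small d -> (d * m <= N)%N ->
  dist (m%:R * a) <= c / d%:R -> (q %| m)%N.
Proof.
move=> d0; rewrite negb_or -ltNge -ltnNge => /andP[dq' dp] dm mdist.
have dr : 0 < d%:R :> R by rewrite ltr0n.
have [qn _] := recordP _ _ rq.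
rewrite /dvdn -leqn0 leqNgt; apply/negP => r0.
have := record_spacing airr rq r0 (ltn_pmod m qn); rewrite leNgt => /negP; apply.
have -> : (m %% q)%N%:R * a = m%:R * a - (m %/ q)%N%:R * (q%:R * a).
  by rewrite {2}(divn_eq m q) natrD natrM; ring.
apply: le_lt_trans (distB _ _) _.
have tN : (m %/ q)%N%:R * q%:R * d%:R <= N%:R :> R.
  rewrite -!natrM ler_nat (leq_trans _ dm) // mulnC leq_mul2l leq_trunc_div orbT //.
have tq : (m %/ q)%N%:R * dist (q%:R * a) < 1 / (4 * q%:R).
  apply: le_lt_trans (ler_wpM2l _ dq) _; first by rewrite ler0n.
  move: dp; rewrite -(ltr_nat R) !natrM => dp.
  rewrite mulrA ltr_pdivrMr // mulrAC mul1r ltr_pdivlMr ?mulr_gt0 //.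
  rewrite -(ltr_pM2r dr); lra.
have cd : c / d%:R < 1 / (4 * q%:R).
  by rewrite ltr_pdivrMr // mulrAC ltr_pdivlMr ?mulr_gt0 //; lra.
have -> : 1 / (2 * q%:R) = 1 / (4 * q%:R) + 1 / (4 * q%:R) :> R.
  by field; rewrite gt_eqF.
apply: ltrD; first exact: le_lt_trans mdist cd.
exact: le_lt_trans (dist_mulrn _ _) tq.
Qed.

(** A union bound: small divisors d > D contribute C N / d^2 each, any other divisor forces q | n,
    and the final 1 is for n = 0. *)
Lemma large_common_divisor_count (D : nat) : (0 < D)%N ->
  \sum_(n < N) (large_common_divisor a b D n)%:R <=
    C * N%:R / D%:R + N%:R / q%:R + 1.
Proof.
move=> D0; have [qn _] := recordP _ _ rq.
pose hit (d n : nat) : bool := (d %| n)%N && (dist ((n %/ d)%N%:R * a) <= c / d%:R).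
have pw (n : 'I_N) : (large_common_divisor a b D n)%:R <=
    \sum_(d < N | (D < d)%N && small d) (hit d n)%:R +
    ((0 < n)%N && (q %| n)%N)%:R + (n == 0 :> nat)%:R :> R.
  have s0 : 0 <= \sum_(d < N | (D < d)%N && small d) (hit d n)%:R :> R.
    by rewrite sumr_ge0.
  case: (boolP (large_common_divisor _ _ _ _)) => [|_]; last by rewrite !addr_ge0.
  rewrite /large_common_divisor; case: (posnP n) => [n0|n0] /=; first by move=> _; rewrite lerDr addr_ge0.
  rewrite addr0 => /existsP[[d /= dn] /and3P[/= Dd ddvd fdvd]].
  have d0 : (0 < d)%N by exact: leq_ltn_trans Dd.
  have nE : n = (d * (n %/ d))%N :> nat by rewrite mulnC divnK.
  have hdn : dist ((n %/ d)%N%:R * a) <= c / d%:R.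
    by apply: (dist_of_divisor (b := b)) => //; rewrite -nE.
  have dN : (d < N)%N by rewrite (leq_ltn_trans _ (ltn_ord n)) // dvdn_leq.
  case: (boolP (small d)) => sd.
    rewrite (bigD1 (Ordinal dN)) /= ?Dd ?sd // /hit ddvd hdn /= -addrA lerDl.
    by rewrite addr_ge0 // sumr_ge0.
  have qm : (q %| n)%N.
    rewrite nE dvdn_mull //; apply: (dvdn_of_dist_large d0 sd) => //.
    by rewrite -nE ltnW.
  by rewrite qm lerDr.
apply: le_trans (ler_sum _ (fun n _ => pw n)) _; rewrite !big_split /=.
apply: lerD; first apply: lerD.
- rewrite exchange_big /=.
  apply: le_trans (_ : \sum_(d < N | (D < d)%N) C * N%:R * (d%:R ^+ 2)^-1 <= _); last first.
    have C0 : 0 <= C by have := c1; rewrite /C; nra.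
    by rewrite -mulr_sumr ler_wpM2l ?mulr_ge0 //; exact: sum_inv_sqr_tail.
  rewrite big_mkcondr; apply: ler_sum => d Dd.
  have d0 : (0 < d)%N by exact: leq_ltn_trans Dd.
  have C0 : 0 <= C by have := c1; rewrite /C; nra.
  case: ifP => sd; last by rewrite !mulr_ge0 // invr_ge0 sqr_ge0.
  apply: le_trans (count_dist_small d0 sd).
  pose F n : R := (dist ((n %/ d)%N%:R * a) <= c / d%:R)%R%:R.
  apply: le_trans (_ : \sum_(n < N.+1) (if (d %| n)%N then F n else 0) <= _).
    rewrite big_ord_recr /= -[leLHS]addr0 lerD //; last by case: ifP.
    by apply: ler_sum => n _; rewrite /hit; case: (d %| n)%N.
  rewrite sum_multiples_le //; apply: ler_sum => m _.
  by rewrite /F mulKn.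
- apply: le_trans (_ : \sum_(n < N.+1) (if (q %| n)%N then (0 < n)%N%:R else 0) <= _).
    rewrite big_ord_recr /= -[leLHS]addr0 lerD //; last by case: ifP.
    by apply: ler_sum => n _; case: (q %| n)%N; rewrite ?andbT ?andbF.
  rewrite (sum_multiples_le (fun n => (0 < n)%N%:R)) //.
  rewrite big_ord_recl muln0 add0r.
  apply: le_trans (_ : \sum_(i < N %/ q) 1 <= _).
    by apply: ler_sum => i _; rewrite lern1 leq_b1.
  rewrite sumr_const card_ord ler_pdivlMr // -natrM ler_nat; exact: leq_trunc_div.
- rewrite -(prednK N0) big_ord_recl big1 ?addr0 // => i _.
Qed.
End Bound.

Lemma large_common_divisor_rare (a b : R) : irrational a ->
  exists2 C : R, 0 < C & forall D : nat, (0 < D)%N ->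
    \forall N \near \oo, avg (fun n => (large_common_divisor a b D n)%:R) N <= C / D%:R.
Proof.
move=> airr; pose c : R := 1 + `|b|.
pose C0 : R := 64 * c ^+ 2 + 68 * c + 136.
have c1 : 1 <= c by rewrite lerDl.
have C00 : 0 < C0 by rewrite /C0; nra.
exists (C0 + 2); first lra.
move=> D D0; have Dr : 0 < D%:R :> R by rewrite ltr0n.
(* This forces D < q: a record q <= D would have da q <= 2 / p with p^2 > N, against da q > 2 / sqrt
   N. Then N / q and 1 are both at most N / D, hence the 2 added to [C0]. *)
have near_d : \forall N \near \oo, forall j : 'I_D.+1, (0 < j)%N ->
    4 / dist (j%:R * a) ^+ 2 < N%:R.
  apply: filter_forall => j; case: (posnP j) => [->|j0]; first exact: nearW.
  by near=> N => _; near: N; exact: nbhs_infty_gtr.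
near=> N.
have DN : (D <= N)%N by near: N; exact: nbhs_infty_ge.
have N0 : (0 < N)%N by exact: leq_trans DN.
have Nr : 0 < N%:R :> R by rewrite ltr0n.
have dN : forall j : 'I_D.+1, (0 < j)%N -> 4 / dist (j%:R * a) ^+ 2 < N%:R by near: N.
have [q [p [rq rp qN Np dq]]] := consecutive_records airr N0.
have [q0 _] := recordP _ _ rq; have [p0 _] := recordP _ _ rp.
have Dq : (D < q)%N.
  rewrite ltnNge; apply/negP => qD.
  have qD' : (q < D.+1)%N by [].
  have := dN (Ordinal qD') q0; rewrite /= => lt.
  have dpos := dist_gt0 airr q0.
  have pr : 0 < p%:R :> R by rewrite ltr0n.
  move: lt; rewrite ltr_pdivrMr ?exprn_gt0 // => lt.
  have : dist (q%:R * a) ^+ 2 <= (2 / p%:R) ^+ 2.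
    by apply: lerXn2r; rewrite ?nnegrE ?divr_ge0 // ltW.
  rewrite expr_div_n ler_pdivlMr ?exprn_gt0 // => le.
  have : N%:R <= p%:R ^+ 2 :> R by rewrite -natrX ler_nat ltnW.
  rewrite -(ler_pM2l (_ : 0 < dist (q%:R * a) ^+ 2)) ?exprn_gt0 //; lra.
rewrite /avg ler_pdivrMr //.
apply: le_trans (large_common_divisor_count _ airr N0 rq rp qN Np dq D0) _.
rewrite -/c -/C0.
have -> : (C0 + 2) / D%:R * N%:R = C0 * N%:R / D%:R + N%:R / D%:R + N%:R / D%:R by ring.
apply: lerD; first apply: lerD => //.
- by rewrite ler_pM2l // lef_pV2 ?posrE ?ltr0n // ler_nat ltnW.
- by rewrite ler_pdivlMr // mul1r ler_nat.
Unshelve. all: by end_near. Qed.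
End Tail.

(** * Euler's product at k + 1 *)

Section EulerProduct.
Context {R : realType} (k : nat) (k0 : (0 < k)%N).

Let z (n : nat) : R := n%:R^-1 ^+ k.+1.

Definition sieved_zeta_sum (ps : seq nat) (X : nat) : R :=
  \sum_(n < X.+1) (if all (fun p => ~~ (p %| n)%N) ps then z n else 0).

Let z0 : z 0 = 0.
Proof. by rewrite /z invr0 expr0n. Qed.

Let z1 : z 1 = 1.
Proof. by rewrite /z invr1 expr1n. Qed.

Let z_ge0 n : 0 <= z n.
Proof. by rewrite exprn_ge0 // invr_ge0. Qed.

Let z_le n : z n <= (n%:R ^+ 2)^-1.
Proof.
case: (posnP n) => [->|n0]; first by rewrite z0 invr_ge0 sqr_ge0.
have nr : 0 < n%:R :> R by rewrite ltr0n.
rewrite -exprVn /z; apply: ler_wiXn2l; rewrite ?invr_ge0 ?invf_le1 ?ler1n //.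
Qed.

Let zM m n : z (m * n) = z m * z n.
Proof. by rewrite /z natrM invfM exprMn. Qed.

(** For [Q] selecting the integers free of primes up to y: apart from 1 they all exceed y, and the
    sum of n^-2 over n > y is at most 1 / y. *)
Let sum_gt_one (Q : pred nat) (y X : nat) : (0 < X)%N -> (0 < y)%N ->
  ~~ Q 0%N -> Q 1%N -> (forall n, (1 < n)%N -> Q n -> (y < n)%N) ->
  1 <= \sum_(n < X.+1) (if Q n then z n else 0) <= 1 + y%:R^-1.
Proof.
case: X => // X _ y0 Q0 Q1 Qy.
rewrite big_ord_recl (negbTE Q0) add0r big_ord_recl Q1 z1.
rewrite lerDl sumr_ge0 //=; last by move=> i _; case: ifP.
rewrite lerD2l; apply: le_trans _ (@sum_inv_sqr_tail R y X.+2 y0).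
rewrite [leRHS]big_mkcond !big_ord_recl /= addrA -[leLHS]add0r lerD //.
  by rewrite addr_ge0 //; case: ifP => // _; rewrite invr_ge0 sqr_ge0.
apply: ler_sum => i _; case: ifP => [Qi|_].
  by rewrite (Qy _ _ Qi) //; exact: z_le.
by case: ifP => // _; rewrite invr_ge0 sqr_ge0.
Qed.

Lemma zeta_sumE (N : nat) :
  \sum_(1 <= n < N.+1) (n%:R `^ (k.+1%:R : R))^-1 = sieved_zeta_sum [::] N.
Proof.
rewrite /sieved_zeta_sum big_ord_recl /= z0 add0r big_add1 big_mkord.
by apply: eq_bigr => n _; rewrite powR_mulrn // /z exprVn.
Qed.

Lemma cvg_zeta_sum : sieved_zeta_sum [::] @ \oo --> zeta (k.+1%:R : R).
Proof.
have -> : zeta (k.+1%:R : R) = limn (sieved_zeta_sum [::]).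
  by rewrite /zeta; congr (limn _); apply/funext => N; exact: zeta_sumE.
apply: nondecreasing_is_cvgn.
  apply/nondecreasing_seqP => X; rewrite /sieved_zeta_sum [leRHS]big_ord_recr.
  by rewrite lerDl.
exists 2 => _ [X _ <-].
rewrite /sieved_zeta_sum big_ord_recl /= z0 add0r.
case: X => [|X]; first by rewrite big_ord0.
rewrite big_ord_recl /= z1 -[leRHS]/(1 + 1) lerD2l.
apply: le_trans _ (_ : (1%N%:R)^-1 <= _); last by rewrite invr1.
apply: le_trans _ (@sum_inv_sqr_tail R 1 X.+2 isT).
rewrite [leRHS]big_mkcond !big_ord_recl /= !add0r.
by apply: ler_sum => i _; exact: z_le.
Qed.

Lemma zeta_ge1 : 1 <= zeta (k.+1%:R : R).
Proof.
have H := cvg_zeta_sum; rewrite -(cvg_lim _ H) //.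
apply: limr_ge; first by apply/cvg_ex; exists (zeta (k.+1%:R : R)).
exists 1%N => // -[//|X] _; rewrite /sieved_zeta_sum !big_ord_recl /= z0 z1 add0r.
by rewrite lerDl sumr_ge0.
Qed.

(** Euler's sieve on partial sums: the terms removed by p have n = p m with m free of the earlier
    primes, so they form p^-(k+1) times the sum cut at X / p. *)
Lemma cvg_sieved_zeta_sum (ps : seq nat) : uniq ps -> all prime ps ->
  sieved_zeta_sum ps @ \oo -->
    zeta (k.+1%:R : R) * \prod_(p <- ps) (1 - (p%:R^-1) ^+ k.+1).
Proof.
elim: ps => [|p ps IHps] /=.
  by move=> _ _; rewrite big_nil mulr1; exact: cvg_zeta_sum.
move=> /andP[pps ups] /andP[pp prs]; have p0 := prime_gt0 pp.
have {}IHps := IHps ups prs; rewrite big_cons.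
have E X : sieved_zeta_sum (p :: ps) X =
    sieved_zeta_sum ps X - p%:R^-1 ^+ k.+1 * sieved_zeta_sum ps (X %/ p).
  apply: (canRL (addrK _)).
  rewrite /sieved_zeta_sum mulr_sumr.
  rewrite (eq_bigr (fun m : 'I_(X %/ p).+1 => (fun n => if all (fun r => ~~ (r %| n)%N) ps then z n else 0) (p * m)%N)).
    rewrite -(sum_multiples_le (fun n => if all (fun r => ~~ (r %| n)%N) ps then z n else 0)) //.
    rewrite -big_split; apply: eq_bigr => n _ /=.
    by case: (p %| n)%N => /=; rewrite ?add0r ?addr0.
  move=> m _ /=; rewrite zM.
  have -> : all (fun r => ~~ (r %| p * m)%N) ps = all (fun r => ~~ (r %| m)%N) ps.
    apply: eq_in_all => r rps; rewrite Gauss_dvdr //.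
    have pr := allP prs _ rps; rewrite prime_coprime // dvdn_prime2 //.
    by apply: contraNN pps => /eqP <-.
  by case: ifP => _; rewrite ?mulr0.
rewrite (funext E).
set l := zeta _ * _ in IHps.
have -> : zeta (k.+1%:R : R) * ((1 - p%:R^-1 ^+ k.+1) * \prod_(j <- ps) (1 - j%:R^-1 ^+ k.+1)) =
    l - p%:R^-1 ^+ k.+1 * l by rewrite /l; ring.
apply: cvgB => //; apply: cvgMr.
exact: (@cvg_comp _ _ _ (fun N => N %/ p)%N (sieved_zeta_sum ps) _ _ _ (cvg_divn p0) IHps).
Qed.

Definition primes_upto (y : nat) : seq nat := [seq p <- iota 0 y.+1 | prime p].

(** Z P is the sum over integers free of primes up to y, hence lies between 1 and 1 + 1 / y;
    dividing by Z >= 1 does not increase the error. *)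
Lemma euler_product_approx (y : nat) : (1 < y)%N ->
  `|\prod_(p <- primes_upto y) (1 - (p%:R^-1) ^+ k.+1) - (zeta (k.+1%:R : R))^-1|
    <= y%:R^-1.
Proof.
move=> y1; have y0 := ltnW y1; set P := \prod_(p <- _) _; set Z := zeta _.
have Z1 : 1 <= Z := zeta_ge1.
have lim : sieved_zeta_sum (primes_upto y) @ \oo --> Z * P.
  by apply: cvg_sieved_zeta_sum; [rewrite filter_uniq ?iota_uniq | exact: filter_all].
have bnd : \forall X \near \oo, 1 <= sieved_zeta_sum (primes_upto y) X <= 1 + y%:R^-1.
  exists 1%N => // X /= X0; apply: (@sum_gt_one (fun n => all (fun p => ~~ (p %| n)%N) (primes_upto y))) => //.
  - apply/allPn; exists 2; first by rewrite mem_filter mem_iota.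
    by rewrite dvdn0.
  - apply/allP => p; rewrite mem_filter => /andP[pp _].
    by rewrite dvdn1; apply: contraTneq pp => ->.
  - move=> n n1 /allP Hn; rewrite ltnNge; apply/negP => ny.
    have := Hn (pdiv n); rewrite pdiv_dvd mem_filter pdiv_prime // mem_iota /= add0n ltnS.
    by rewrite (leq_trans (pdiv_leq _) ny) ?(ltnW n1) // => /(_ isT).
have cv : cvgn (sieved_zeta_sum (primes_upto y)) by apply/cvg_ex; exists (Z * P).
have lo : 1 <= Z * P.
  rewrite -(cvg_lim _ lim) //; apply: limr_ge => //.
  by apply: filterS bnd => X /andP[].
have hi : Z * P <= 1 + y%:R^-1.
  rewrite -(cvg_lim _ lim) //; apply: limr_le => //.
  by apply: filterS bnd => X /andP[].
have Z0 : 0 < Z by rewrite (lt_le_trans ltr01).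
have -> : P - Z^-1 = (Z * P - 1) / Z by field; rewrite gt_eqF.
rewrite ger0_norm ?divr_ge0 ?subr_ge0 // ?(le_trans ler01) //.
rewrite ler_pdivrMr // (le_trans (_ : _ <= y%:R^-1)) ?ler_peMr ?invr_ge0 //.
by rewrite lerBlDl.
Qed.
End EulerProduct.

(** * Assembling the density *)

Section Density.
Context {R : realType}.

(** [avg] runs over 0 <= n < N and [density_ratio] over 1 <= n <= N; this shift by one costs O(1 /
    N). *)
Lemma density_ratio_avg (A : set nat) (l : R) :
  avg (fun n => (n \in A)%:R) @ \oo --> l -> density_ratio R A @ \oo --> l.
Proof.
move=> Al; pose u n : R := (n \in A)%:R.
have u1 n : `|u n| <= 1 by rewrite /u ger0_norm // lern1 leq_b1.
have -> : density_ratio R A = fun N => (\sum_(n < N) (u (n + 1)%N - u n)) / N%:R + avg u N.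
  apply/funext => N; rewrite /avg -mulrDl sumrB subrK /density_ratio; congr (_ / _).
  rewrite -sum1_count natr_sum big_mkcond /=.
  rewrite -[N in iota 1 N](addnK 1 N) -/(index_iota 1 (N + 1)) addn1 big_add1 big_mkord.
  by apply: eq_bigr => n _; rewrite /u addn1; case: (_ \in A).
rewrite -[l]add0r; apply: cvgD => //.
apply: (@squeeze_cvgr _ _ _ _ (fun N => - (1%:R * (2 * 1) / N%:R)) (fun N => 1%:R * (2 * 1) / N%:R)).
- apply: nearW => N; rewrite -ler_norml normrM normfV normr_nat.
  by rewrite ler_wpM2r ?invr_ge0 //; exact: sum_shift_bound.
- by rewrite -[X in _ --> X]oppr0; apply: cvgN; exact: cvg_invn.
- exact: cvg_invn.
Qed.

(** If the gcd passes the sieve but is not 1, its least prime factor exceeds y and is a large common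
    divisor; at n = 0 the error term is already 1. *)
Lemma sieved_sub_coprime (k : nat) (f : 'I_k -> {poly R}) (i0 : 'I_k) (y n : nat) :
  size (f i0) = 2%N -> (0 < y)%N ->
  let a : R := (n \in [set n : nat | (0 < n)%N /\ gcd_floors f n = 1%N])%:R in
  a <= (sieved f 1 (primes_upto y) n)%:R +
       (large_common_divisor (f i0)`_1 (f i0)`_0 y n)%:R /\
  (sieved f 1 (primes_upto y) n)%:R <=
    a + (large_common_divisor (f i0)`_1 (f i0)`_0 y n)%:R.
Proof.
move=> sf y0 /=.
have fE : (f i0).[n%:R] = (f i0)`_1 * n%:R + (f i0)`_0.
  by rewrite horner_coef sf !big_ord_recl big_ord0 /= expr0 expr1; ring.
case: (posnP n) => [->|n0].
  have b1 (c : bool) : c%:R <= 1 :> R by rewrite lern1 leq_b1.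
  by split; apply: le_trans (b1 _) _; rewrite /large_common_divisor eqxx lerDr.
case: (boolP (n \in _)) => [|nA].
  rewrite inE /= => -[_ g1]; rewrite /sieved g1 /=.
  have -> : all (fun p => ~~ (p %| 1)%N) (primes_upto y).
    apply/allP => p; rewrite mem_filter => /andP[pp _].
    by rewrite dvdn1; apply: contraTneq pp => ->.
  by split; rewrite lerDl.
rewrite add0r; split; first by rewrite addr_ge0.
case: (boolP (sieved _ _ _ _)) => // /andP[_ /allP sv].
have g0 : (0 < gcd_floors f n)%N by rewrite /gcd_floors gcdn_gt0 n0.
have g1 : (1 < gcd_floors f n)%N.
  rewrite ltn_neqAle g0 andbT eq_sym; apply: contraNN nA => /eqP g1.
  by rewrite inE /=.
have pp := pdiv_prime g1; have pg := pdiv_dvd (gcd_floors f n).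
have := pg; rewrite dvdn_gcd_floors => /andP[pn /forallP/(_ i0) pf].
rewrite (_ : large_common_divisor _ _ _ _) //.
rewrite /large_common_divisor gtn_eqF //=; apply/existsP.
have pn' : (pdiv (gcd_floors f n) < n.+1)%N by rewrite ltnS dvdn_leq.
exists (Ordinal pn') => /=; rewrite pn -fE pf !andbT ltnNge; apply/negP => py.
have := sv (pdiv (gcd_floors f n)).
by rewrite mem_filter pp mem_iota /= add0n ltnS py pg => /(_ isT).
Qed.
End Density.

Unset Implicit Arguments.
Set Strict Implicit.

Theorem corollary1p2 (R : realType) (k : nat) (hk : (0 < k)%N)
    (f : 'I_k -> {poly R})
    (hdeg : size (f (Ordinal hk)) = 2%N)
    (hirr : forall h : 'I_k -> int, (exists i : 'I_k, h i <> 0) ->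
      exists j : nat, (0 < j)%N /\ irrational (lincomb h f)`_j) :
  let A := [set n : nat | (0 < n)%N /\ gcd_floors f n = 1%N] in
  cvgn (density_ratio R A) /\ dens R A = (zeta (k.+1%:R : R))^-1.
Proof.
move=> A; set i0 := Ordinal hk in hdeg.
suff H : density_ratio R A @ \oo --> (zeta (k.+1%:R : R))^-1.
  split; last exact: cvg_lim.
  by apply/cvg_ex; exists (zeta (k.+1%:R : R))^-1.
apply: density_ratio_avg.
(* For [h] the unit vector at [i0], the irrational coefficient can only be the slope, since the
   polynomial has degree one. *)
have airr : irrational (f i0)`_1.
  have [|j [j0 jirr]] := hirr (fun i => (i == i0)%:Z); first by exists i0; rewrite eqxx.
  have lE : lincomb (fun i => (i == i0)%:Z) f = f i0.
    rewrite /lincomb (bigD1 i0) //= ?eqxx scale1r big1 ?addr0 // => i /negbTE ->.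
    by rewrite scale0r.
  move: jirr; rewrite lE; case: j j0 => [//|[//|j]] _ irr; exfalso; apply: irr.
  by rewrite nth_default ?hdeg //; exact: (rational_nat 0).
have [C C0 rare] := large_common_divisor_rare (f i0)`_0 airr.
set b := (f i0)`_0 in rare; set a := (f i0)`_1 in rare airr.
apply/cvgrPdist_le => e e0.
(* y is fixed before N: C / y is the share of large common divisors, and the two further 1 / y are
   the errors of Euler's product and of the sieve average. *)
have [y y1 ye] : exists2 y : nat, (1 < y)%N & (C + 2) / y%:R <= e.
  exists (Num.truncn ((C + 2) / e)).+2 => //.
  rewrite ler_pdivrMr ?ltr0n // mulrC -ler_pdivrMr // ltW //.
  by apply: lt_trans (truncnS_gt _) _; rewrite ltr_nat.
have y0 := ltnW y1; have yr : 0 < y%:R :> R by rewrite ltr0n.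
have ps_prime p : p \in primes_upto y -> prime p /\ coprime 1 p.
  by rewrite mem_filter => /andP[pp _]; rewrite coprime1n.
have ps_uniq : uniq (primes_upto y) by rewrite filter_uniq ?iota_uniq.
have sv := density_sieved hirr (ltn0Sn 0) ps_uniq ps_prime.
rewrite invr1 expr1n mul1r in sv.
have eu := @euler_product_approx R k hk y y1.
set P := \prod_(p <- _) _ in sv eu.
have yV : 0 < y%:R^-1 :> R by rewrite invr_gt0.
have svy : \forall N \near \oo, `|P - avg (fun n => (sieved f 1 (primes_upto y) n)%:R) N| <= y%:R^-1.
  by move/cvgrPdist_le: sv; apply.
near=> N.
have s1 : `|P - avg (fun n => (sieved f 1 (primes_upto y) n)%:R) N| <= y%:R^-1 by near: N.
have s2 : avg (fun n => (large_common_divisor a b y n)%:R) N <= C / y%:R.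
  by near: N; exact: rare.
have cmp n := @sieved_sub_coprime R k f i0 y n hdeg y0.
have l1 := le_avg N (fun n => (cmp n).1); have l2 := le_avg N (fun n => (cmp n).2).
rewrite !avgD in l1 l2.
have ye' : C * y%:R^-1 + 2 * y%:R^-1 <= e by rewrite -mulrDl.
move: s1 eu; rewrite !ler_norml => /andP[? ?] /andP[? ?].
rewrite -/A -/a -/b in l1 l2.
by apply/andP; split; lra.
Unshelve. all: by end_near. Qed.
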